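(* Let $\mathcal{Z}$ be an open subset of $\mathbb{R}^n$, let $\mathcal{J}:\mathcal{Z}\to\mathbb{R}$ be a function with a global minimizer $z^*\in\mathcal{Z}$, and let $\eta>0$ be a constant. If $\mathcal{J}$ is a proper objective function, then the perturbed gradient flow $$\dot z(t)=-\eta\nabla\mathcal{J}(z(t))+e(t),$$ with input (perturbation) $e$, is small-disturbance input-to-state stable (on the state space $\mathcal{Z}$, with respect to the equilibrium $z^*$).
   Context: $\mathbb{R}_+=[0,\infty)$. The perturbation $e:\mathbb{R}_+\to\mathbb{R}^n$ is measurable and locally essentially bounded; $\|\cdot\|$ is the Euclidean norm and $\|e\|_\infty=\operatorname{ess\,sup}_{s\ge 0}\|e(s)\|$. Comparison functions: A $\mathcal{K}$-function is a function $\alpha:\mathbb{R}_+\to\mathbb{R}_+$ that is continuous, strictly increasing, and vanishes at zero (it may be bounded). For $d>0$, a $\mathcal{K}_{[0,d)}$-function is a function $[0,d)\to\mathbb{R}_+$ that is continuous, strictly increasing, and vanishes at zero. A $\mathcal{KL}$-function is a function $\beta:\mathbb{R}_+\times\mathbb{R}_+\to\mathbb{R}_+$ such that $\beta(\cdot,t)$ is a $\mathcal{K}$-function for each fixed $t\ge0$, and for each fixed $r\ge0$, $\beta(r,\cdot)$ is decreasing with $\beta(r,t)\to0$ as $t\to\infty$. Size function: $\mathcal{V}:\mathcal{Z}\to\mathbb{R}_+$ is a size function for $(\mathcal{Z},z^* )$ if it is (1) continuous; (2) positive definite with respect to $z^*$, i.e. $\mathcal{V}(z^* )=0$ and $\mathcal{V}(z)>0$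 for all $z\in\mathcal{Z}$, $z\ne z^*$; (3) coercive, i.e. for any sequence $\{z_k\}$ in $\mathcal{Z}$ with $z_k\to\partial\mathcal{Z}$ or $\|z_k\|\to\infty$, one has $\mathcal{V}(z_k)\to\infty$ as $k\to\infty$. Proper objective function: $\mathcal{J}:\mathcal{Z}\to\mathbb{R}$ is a proper objective function if (1) $\mathcal{J}$ is smooth; (2) $z\mapsto\mathcal{J}(z)-\mathcal{J}(z^* )$ is a size function for $(\mathcal{Z},z^* )$; (3) there exists a $\mathcal{K}$-function $\alpha_3$ such that $\|\nabla\mathcal{J}(z)\|\ge\alpha_3(\mathcal{J}(z)-\mathcal{J}(z^* ))$ for all $z\in\mathcal{Z}$. Small-disturbance ISS: the system is small-disturbance input-to-state stable if there exist a size function $\mathcal{V}$ for $(\mathcal{Z},z^* )$, a constant $d>0$ (possibly $\infty$), a $\mathcal{KL}$-function $\beta$, and a $\mathcal{K}_{[0,d)}$-function $\gamma$ such that for all inputs $e$ with $\|e\|_\infty<d$ and all initial states $z(0)\in\mathcal{Z}$, the solution $z(t)$ remains in $\mathcal{Z}$ and satisfies $\mathcal{V}(z(t))\le\beta(\mathcal{V}(z(0)),t)+\gamma(\|e\|_\infty)$ for all $t\ge0$. *)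

(* Defs.v *)
From HB Require Import structures.
From mathcomp Require Import all_boot all_order all_algebra.
From mathcomp Require Import all_classical all_reals all_analysis.
From mathcomp Require Import measurable_realfun ess_sup_inf.

Set Implicit Arguments.
Unset Strict Implicit.
Unset Printing Implicit Defensive.

Import Order.TTheory GRing.Theory Num.Theory.
Import numFieldNormedType.Exports.

Local Open Scope classical_set_scope.
Local Open Scope ring_scope.

Section Euclidean.
Context {R : realType} {n : nat}.
Implicit Types (Z : set 'rV[R]_n) (J : 'rV[R]_n -> R) (z : 'rV[R]_n).

(* The library norm [`|z|] on ['rV[R]_n] is the sup norm (it induces the same
   topology). *)
Definition enorm z : R := Num.sqrt (\sum_(i < n) z ord0 i ^+ 2).

Definition partial (i : 'I_n) J z : R := 'D_(delta_mx ord0 i) J z.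

Definition grad J z : 'rV[R]_n := \row_i partial i J z.

(* Functions on [Z] are represented by total functions of which only the values
   on [Z] matter: for an open [Z], everything below depends only on the
   restriction of [J] to [Z]. *)
Fixpoint Ck_on (k : nat) Z J : Prop :=
  if k is k'.+1 then
    (forall z, Z z -> differentiable J z) /\
    (forall i, Ck_on k' Z (partial i J))
  else forall z, Z z -> {for z, continuous J}.

Definition smooth_on Z J : Prop := forall k, Ck_on k Z J.

Definition boundary Z : set 'rV[R]_n := closure Z `\` interior Z.

(* [dist (u k, boundary Z)] tends to 0; this is false for every [u] when the
   boundary is empty. *)
Definition tends_to_boundary Z (u : nat -> 'rV[R]_n) : Prop :=
  forall eps : R, 0 < eps ->
    \forall k \near \oo, exists w, boundary Z w /\ enorm (u k - w) < eps.

Definition coercive Z (V : 'rV[R]_n -> R) : Prop :=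
  forall u : nat -> 'rV[R]_n, (forall k, Z (u k)) ->
    tends_to_boundary Z u \/ enorm (u k) @[k --> \oo] --> +oo ->
    V (u k) @[k --> \oo] --> +oo.

Record size_function Z (zstar : 'rV[R]_n) (V : 'rV[R]_n -> R) : Prop := {
  size_continuous : {within Z, continuous V};
  size_zero : V zstar = 0;
  size_pos : forall z, Z z -> z <> zstar -> 0 < V z;
  size_coercive : coercive Z V }.

End Euclidean.

Section ComparisonFunctions.
Context {R : realType}.

(* Only the values on [0, d) matter; nonnegativity there follows from
   monotonicity and [alpha 0 = 0]. *)
Record K_function_on (d : \bar R) (alpha : R -> R) : Prop := {
  K_continuous :
    {within [set r : R | 0 <= r /\ (r%:E < d)%E], continuous alpha};
  K_increasing :
    forall r s : R, 0 <= r -> r < s -> (s%:E < d)%E -> alpha r < alpha s;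
  K_zero : alpha 0 = 0 }.

Definition K_function : (R -> R) -> Prop := K_function_on +oo%E.

(* [beta r] is required to be nonincreasing only: strictness is impossible at
   [r = 0], where [beta 0 t = 0] for all [t]. *)
Record KL_function (beta : R -> R -> R) : Prop := {
  KL_K : forall t : R, 0 <= t -> K_function (fun r => beta r t);
  KL_decreasing : forall r s t : R, 0 <= r -> 0 <= s -> s <= t ->
    beta r t <= beta r s;
  KL_cvg0 : forall r : R, 0 <= r -> beta r t @[t --> +oo] --> (0 : R) }.

End ComparisonFunctions.

Definition proper_objective {R : realType} {n : nat} (Z : set 'rV[R]_n)
    (zstar : 'rV[R]_n) (J : 'rV[R]_n -> R) : Prop :=
  [/\ smooth_on Z J,
      size_function Z zstar (fun z => J z - J zstar) &
      exists2 alpha3, K_function alpha3 &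
        forall z, Z z -> alpha3 (J z - J zstar) <= enorm (grad J z)].

Section Systems.
Context {R : realType} {n : nat}.
Local Notation mu := (@lebesgue_measure R).

(* Signals on [0, +oo) are represented by functions on [R] whose values at
   negative times are irrelevant. *)

(* The real line with the sigma-algebra of Lebesgue-measurable sets (the
   library's default one is the Borel sigma-algebra). *)
Definition lebesgue_type := g_sigma_algebraType (completed_algebra_gen mu).

Definition measurable_input (e : R -> 'rV[R]_n) : Prop :=
  forall i : 'I_n, measurable_fun (`[0, +oo[%classic : set lebesgue_type)
    (fun t : lebesgue_type => e t ord0 i : measurableTypeR R).

Definition locally_ess_bounded (e : R -> 'rV[R]_n) : Prop :=
  forall b : R, 0 <= b -> exists M : R,
    \forall s \ae mu, 0 <= s <= b -> enorm (e s) <= M.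

Definition admissible_input (e : R -> 'rV[R]_n) : Prop :=
  measurable_input e /\ locally_ess_bounded e.

Definition ess_norm (e : R -> 'rV[R]_n) : \bar R :=
  ess_sup mu (fun s : R => if 0 <= s then (enorm (e s))%:E else 0%E).

Definition abs_continuous_on (a b : R) (z : R -> 'rV[R]_n) : Prop :=
  forall eps : R, 0 < eps -> exists2 delta : R, 0 < delta &
    forall (m : nat) (u v : 'I_m -> R),
      (forall k, [/\ a <= u k, u k <= v k & v k <= b]) ->
      trivIset [set: 'I_m] (fun k => `]u k, v k[%classic) ->
      \sum_(k < m) (v k - u k) < delta ->
      \sum_(k < m) enorm (z (v k) - z (u k)) < eps.

(* Caratheodory solution of z' = f (z, e), z(0) = z0, on [0, T) with values in
   the state space [Z]. *)
Record solution_on (Z : set 'rV[R]_n) (f : 'rV[R]_n -> 'rV[R]_n -> 'rV[R]_n)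
    (e : R -> 'rV[R]_n) (T : \bar R) (z0 : 'rV[R]_n) (z : R -> 'rV[R]_n) :
    Prop := {
  sol_init : z 0 = z0;
  sol_in : forall t : R, 0 <= t -> (t%:E < T)%E -> Z (z t);
  sol_ac : forall b : R, 0 <= b -> (b%:E < T)%E -> abs_continuous_on 0 b z;
  sol_ode : \forall t \ae mu, 0 < t -> (t%:E < T)%E ->
    is_derive (t : R) (1 : R) z (f (z t) (e t)) }.

(* [z] is the solution issued from [z0]: it is defined (and stays in [Z]) on
   the whole of [0, +oo), and every solution from [z0] on some [0, T) is a
   restriction of it. *)
Definition the_solution (Z : set 'rV[R]_n)
    (f : 'rV[R]_n -> 'rV[R]_n -> 'rV[R]_n) (e : R -> 'rV[R]_n)
    (z0 : 'rV[R]_n) (z : R -> 'rV[R]_n) : Prop :=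
  solution_on Z f e +oo%E z0 z /\
  forall (T : \bar R) (z' : R -> 'rV[R]_n), solution_on Z f e T z0 z' ->
    forall t : R, 0 <= t -> (t%:E < T)%E -> z' t = z t.

Definition small_disturbance_ISS (Z : set 'rV[R]_n) (zstar : 'rV[R]_n)
    (f : 'rV[R]_n -> 'rV[R]_n -> 'rV[R]_n) : Prop :=
  exists (V : 'rV[R]_n -> R) (d : \bar R) (beta : R -> R -> R) (gamma : R -> R),
    [/\ size_function Z zstar V, (0 < d)%E, KL_function beta,
        K_function_on d gamma &
        forall (e : R -> 'rV[R]_n) (z0 : 'rV[R]_n),
          admissible_input e -> (ess_norm e < d)%E -> Z z0 ->
          exists2 z : R -> 'rV[R]_n, the_solution Z f e z0 z &
            forall t : R, 0 <= t ->
              V (z t) <= beta (V z0) t + gamma (fine (ess_norm e))].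

End Systems.

Definition perturbed_gradient_flow {R : realType} {n : nat} (eta : R)
    (J : 'rV[R]_n -> R) (z e : 'rV[R]_n) : 'rV[R]_n :=
  - (eta *: grad J z) + e.

(* Main.v *)
(* The Lyapunov function is W = J - J zstar: along a solution
   W' <= - (eta / 4) alpha3(s)^2 as soon as W >= s and eta alpha3(s) >= 2 D,
   where D bounds the perturbation. Hence sublevel sets of W above the level
   gamma(D), with alpha3(gamma(D)) = 2 D / eta, are invariant, and W needs at
   most the time (r - s) / ((eta / 4) alpha3(s)^2) to drop from r to such an s;
   this gives the gain gamma, defined for D < (eta / 2) alpha3(1), and the
   decay estimate beta(r, t) = s, where s + t (eta / 4) alpha3(s)^2 = r.
   Sublevel sets of W are compact by coercivity, so a solution is obtained by
   Picard iteration for a globally Lipschitz modification of the field. All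
   differential inequalities between absolutely continuous functions reduce to
   the monotonicity of an absolutely continuous function whose right derivative
   is nonpositive almost everywhere. *)
Require Import Defs.
From HB Require Import structures.
From mathcomp Require Import all_boot all_order all_algebra.
From mathcomp Require Import all_classical all_reals all_analysis.
From mathcomp Require Import measurable_realfun ess_sup_inf ring lra.

Set Implicit Arguments.
Unset Strict Implicit.
Unset Printing Implicit Defensive.

Import Order.TTheory GRing.Theory Num.Theory.
Import numFieldNormedType.Exports.

Local Open Scope classical_set_scope.
Local Open Scope ring_scope.

(** Existence for all time and the energy estimate depend on each other: the modified field is the
    true one only on a sublevel set, and the estimate holds only while the solution stays there. The
    modification therefore leaves a margin of one unit above the invariant level, and an induction
    along the real half-line uses the estimate to bring the solution back under that level before
    the margin is used up. A K-function may be bounded, so [alpha3] has an inverse only on a bounded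
    range; cutting at level 1 is an arbitrary choice, and it is the source of the bound on the
    disturbance. Right derivatives appear because invariance is proved for the maximum of [s] and
    the energy, which can have corners. *)

Lemma maxr_lipschitz {R : realDomainType} (c s t : R) :
  `|Num.max c t - Num.max c s| <= `|t - s|.
Proof.
rewrite /Num.max; case: ltP => s0; case: ltP => t0 //.
- by rewrite !ler_norml; have := ler_norm (t - s); lra.
- by rewrite distrC [leRHS]distrC ler_norml; have := ler_norm (s - t); lra.
- by rewrite subrr normr0.
Qed.

#[global] Instance lebesgue_ae_filter (R : realType) :
  Filter (nbhs (almost_everywhere (@lebesgue_measure R))).
Proof. exact: (ae_filter_ringOfSetsType (@lebesgue_measure R)). Qed.

(** * Absolutely continuous functions *)

Section RealInduction.
Context {R : realType}.

(** All points before the infimum of the counterexamples are good, so the step hypothesis covers an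
    interval starting at the infimum, which is absurd. This hypothesis asks at once for the passage
    to the limit at [t] and for the extension beyond [t]. *)
Lemma real_induction (a : R) (P : R -> Prop) :
  (forall t, a <= t -> (forall s, a <= s -> s < t -> P s) ->
     exists2 d, 0 < d & forall s, t <= s -> s < t + d -> P s) ->
  forall t, a <= t -> P t.
Proof.
move=> step x ax; apply: contrapT => nPx.
pose S := [set t | a <= t /\ ~ P t].
have S0 : S x by [].
have lbS : has_lbound S by exists a => y [].
have iS : has_inf S by split => //; exists x.
have ai : a <= inf S by apply: lb_le_inf; [exists x|move=> y []].
have [|d d0 Pd] := step _ ai.
  move=> s as_ sS; apply: contrapT => nPs.
  by move: sS; rewrite ltNge (ge_inf lbS).
have [y [ay nPy] ylt] := inf_adherent d0 iS.
by apply: (nPy); apply: Pd => //; exact: ge_inf.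
Qed.

End RealInduction.

Section AbsoluteContinuity.
Context {R : realType}.
Local Notation mu := (@lebesgue_measure R).

(** Scalar counterpart of [abs_continuous_on]: vector curves are treated one coordinate at a
    time. *)
Definition scalar_ac (a b : R) (f : R -> R) :=
  forall eps : R, 0 < eps -> exists2 delta : R, 0 < delta &
    forall (m : nat) (u v : 'I_m -> R),
      (forall k, [/\ a <= u k, u k <= v k & v k <= b]) ->
      trivIset [set: 'I_m] (fun k => `]u k, v k[%classic) ->
      \sum_(k < m) (v k - u k) < delta ->
      \sum_(k < m) `|f (v k) - f (u k)| < eps.

Lemma scalar_ac_unif a b f : scalar_ac a b f ->
  forall eps : R, 0 < eps -> exists2 delta : R, 0 < delta &
    forall s t, a <= s -> s <= t -> t <= b -> t - s < delta ->
      `|f t - f s| < eps.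
Proof.
move=> acf e e0; have [d d0 fd] := acf e e0; exists d => // s t as_ st tb tsd.
have := fd 1%N (fun=> s) (fun=> t); rewrite !big_ord1; apply => //.
by move=> i j _ _ _; rewrite !ord1.
Qed.

(** Additivity of Lebesgue measure. This is how an open set of small measure meets the total-length
    condition of absolute continuity. *)
Lemma sum_disjoint_itv_le (m : nat) (u v : 'I_m -> R) (U : set R) :
  (forall k, u k <= v k) -> measurable U ->
  trivIset [set: 'I_m] (fun k => `]u k, v k[%classic) ->
  (forall k, `]u k, v k[ `<=` U) ->
  ((\sum_(k < m) (v k - u k))%:E <= lebesgue_measure U)%E.
Proof.
move=> uv mU tI sU.
have mF (k : 'I_m) : measurable (`]u k, v k[%classic : set R).
  exact: measurable_itv.
have mUF : measurable (\big[setU/set0]_(k < m) `]u k, v k[%classic : set R).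
  exact: bigsetU_measurable.
have := @measure_semi_additive_ord _ _ _ (@lebesgue_measure R) m _ mF tI mUF.
rewrite [X in _ = X -> _](eq_bigr (fun k => (v k - u k)%:E)); last first.
  move=> k _; rewrite [LHS]lebesgue_measure_itv/= lte_fin; case: ifPn => //.
  by rewrite -leNgt => vu; rewrite (@le_anti _ _ (v k) (u k)) ?subrr// vu uv.
rewrite sumEFin => <-; apply: le_measure; rewrite ?inE//.
by elim/big_ind : _ => // A B AU BU x [/AU|/BU].
Qed.

(* [G t] is the supremum of the sums of [f] over disjoint intervals of
   [[a, t]] inside an open set [U] of small measure containing the exceptional
   points: at these points the increments of [f] are controlled by those of
   [G], elsewhere by the derivative. *)
Lemma scalar_ac_nincr (a b : R) (f : R -> R) : a <= b -> scalar_ac a b f ->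
  (\forall t \ae (@lebesgue_measure R), a < t -> t < b -> forall eps : R, 0 < eps ->
    exists2 d : R, 0 < d & forall s, t < s -> s < t + d ->
      f s - f t <= eps * (s - t)) ->
  f b <= f a.
Proof.
move=> ab acf aef.
suff Heps (eps : R) : 0 < eps -> f b - f a <= eps * (b - a) + eps.
  rewrite -subr_le0; apply/ler_addgt0Pr => e e0; rewrite add0r.
  have h : 0 < b - a + 1 by rewrite ltr_wpDl// subr_ge0.
  have /Heps : 0 < e / (b - a + 1) by rewrite divr_gt0.
  move=> /le_trans; apply.
  by rewrite -[X in _ + X]mulr1 -mulrDr divfK// gt_eqF.
move=> e0; have [d d0 fd] := acf _ e0.
(* The left end [a] is counted as exceptional, since the hypothesis says nothing there. *)
pose N := [set t | ~ (a < t -> t < b -> forall eps : R, 0 < eps ->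
    exists2 d : R, 0 < d & forall s, t < s -> s < t + d ->
      f s - f t <= eps * (s - t))] `|` [set a].
have negN : (@lebesgue_measure R).-negligible N.
  apply: negligibleU; first exact: aef.
  by apply/negligibleP; [exact: measurable_set1|exact: lebesgue_measure_set1].
have d20 : 0 < d / 2 by rewrite divr_gt0.
have [U [oU NU mU]] := outer_measure_open_le N d20.
move: mU; rewrite (negligible_outer_measure N).1// add0e => mU.
pose S t := [set x | exists (m : nat) (u v : 'I_m -> R),
  [/\ (forall k, [/\ a <= u k, u k <= v k & v k <= t]),
      trivIset [set: 'I_m] (fun k => `]u k, v k[%classic),
      (forall k, `]u k, v k[ `<=` U) &
      x = \sum_(k < m) `|f (v k) - f (u k)|]].
have Slt t x : t <= b -> S t x -> x < eps.
  move=> tb [m [u [v [uv tI uvU ->]]]]; apply: fd => //.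
    by move=> k; have [? ? vt] := uv k; split=> //; exact: le_trans tb.
  rewrite -lte_fin; apply: le_lt_trans.
    apply: (@sum_disjoint_itv_le _ _ _ U) => //; last exact: open_measurable.
    by move=> k; have [] := uv k.
  by apply: le_lt_trans mU _; rewrite lte_fin; lra.
have S0 t : S t 0.
  exists 0%N, (fun=> 0), (fun=> 0); rewrite big_ord0; split => //; move=> [] //.
pose G t := sup (S t).
have Sub t : t <= b -> has_ubound (S t).
  by move=> tb; exists eps => x /(Slt _ _ tb)/ltW.
have G0 t : t <= b -> 0 <= G t by move=> tb; apply: ub_le_sup => //; exact: Sub.
have Gle t : t <= b -> G t <= eps.
  by move=> tb; apply: ge_sup; [exists 0|move=> x /(Slt _ _ tb)/ltW].
have Gmono s t : s <= t -> t <= b -> G s <= G t.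
  move=> st tb; apply: ge_sup; first by exists 0.
  move=> x [m [u [v [uv tI uvU xE]]]]; apply: ub_le_sup; first exact: Sub.
  exists m, u, v; split => // k; have [? ? vs] := uv k.
  by split => //; exact: le_trans st.
have Gstep s t : a <= s -> s <= t -> t <= b -> `]s, t[ `<=` U ->
    G s + `|f t - f s| <= G t.
  move=> as_ st tb stU; rewrite -lerBrDr; apply: ge_sup; first by exists 0.
  move=> x [m [u [v [uv tI uvU ->]]]]; rewrite lerBrDr.
  apply: ub_le_sup; first exact: Sub.
  (* The interval from [s] to [t] is appended as last member of the family; the earlier ones end at
     or before [s]. *)
  pose u' (k : 'I_m.+1) := if unlift ord_max k is Some j then u j else s.
  pose v' (k : 'I_m.+1) := if unlift ord_max k is Some j then v j else t.
  exists m.+1, u', v'; split.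
  - move=> k; rewrite /u' /v'; case: unliftP => [j _|_] //.
    by have [? ? vs] := uv j; split => //; exact: le_trans st.
  - have disj j : `]u j, v j[ `&` `]s, t[ = set0.
      rewrite -subset0 => y [] /=; rewrite !in_itv/= => /andP[_ yv] /andP[sy _].
      by have [_ _ vs] := uv j; lra.
    apply/trivIsetP => i j _ _; rewrite /u' /v'.
    case: unliftP => [i' ->|->]; case: unliftP => [j' ->|->] ij.
    + by move/trivIsetP : tI; apply => //; apply: contraNneq ij => ->.
    + exact: disj.
    + by rewrite setIC; exact: disj.
    + by rewrite eqxx in ij.
  - by move=> k; rewrite /u' /v'; case: unliftP.
  - rewrite big_ord_recr/= /u' /v' unlift_none; congr (_ + _).
    apply: eq_bigr => k _.
    have -> : widen_ord (leqnSn m) k = lift ord_max k.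
      by apply: val_inj; rewrite /= /bump leqNgt ltn_ord.
    by rewrite liftK.
suff P t : a <= t -> t <= b -> f t - f a <= eps * (t - a) + G t.
  by apply: (le_trans (P _ ab (lexx _))); rewrite lerD2l Gle.
move: t; apply: real_induction => t at_ IH.
have [bt|tb] := ltP b t.
  by exists 1 => // s ts _ sb; lra.
(* The bound at [t] itself: it holds at points just before [t], and [f] changes little from there to
   [t]. *)
have Pt : f t - f a <= eps * (t - a) + G t.
  move: at_; rewrite le_eqVlt => /predU1P[<-|at_].
    by rewrite !subrr mulr0 add0r G0.
  apply/ler_addgt0Pr => eta eta0.
  have [dl dl0 fdl] := scalar_ac_unif acf eta0.
  pose s := Num.max a (t - dl / 2).
  have as_ : a <= s by rewrite le_max lexx.
  have st : s < t by rewrite gt_max at_/=; lra.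
  have := IH _ as_ st (ltW (lt_le_trans st tb)).
  have := fdl _ _ as_ (ltW st) tb; have -> : t - s < dl.
    by rewrite ltrBlDr -ltrBlDl lt_max; apply/orP; right; lra.
  move=> /(_ isT); rewrite ltr_norml => /andP[_ fts].
  have := Gmono _ _ (ltW st) tb.
  have : eps * (s - a) <= eps * (t - a) by rewrite ler_pM2l// lerD2r ltW.
  lra.
have [tN|tN] := pselect (N t).
  have : nbhs t U by apply: open_nbhs_nbhs; split => //; exact: NU.
  move=> /nbhs_ballP[r /= r0 rU]; exists r => // s ts str sb.
  have := Gstep _ _ at_ ts sb; have H : `]t, s[ `<=` U.
    move=> x /=; rewrite in_itv/= => /andP[tx xs]; apply: rU.
    by rewrite /ball/= ltr_distlC; apply/andP; split; lra.
  move=> /(_ H); have := ler_norm (f s - f t).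
  have : eps * (t - a) <= eps * (s - a) by rewrite ler_pM2l// lerD2r.
  lra.
have at' : a < t.
  by rewrite lt_neqAle at_ andbT; apply/eqP => aE; apply: tN; right.
have [tb'|bt] := ltP t b; last first.
  exists 1 => // s ts _ sb; have -> // : s = t by lra.
have Dt : exists2 d, 0 < d &
    forall s, t < s -> s < t + d -> f s - f t <= eps * (s - t).
  apply: contrapT => nD; apply: tN; left => H; apply: nD.
  exact: (H at' tb' _ e0).
case: Dt => r r0 fr.
exists r => // s; rewrite le_eqVlt => /predU1P[<-//|ts] str sb.
have := fr _ ts str; have := Gmono _ _ (ltW ts) sb; lra.
Qed.

(** Links derivatives to the one-sided condition of [scalar_ac_nincr], which is weak enough to hold
    also at the corners of a maximum. *)
Lemma is_derive_dini (f : R -> R) (t l : R) : is_derive t 1 f l -> l <= 0 ->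
  forall eps : R, 0 < eps ->
    exists2 d : R, 0 < d & forall s, t < s -> s < t + d ->
      f s - f t <= eps * (s - t).
Proof.
move=> [df dfl] l0 eps e0.
have : h^-1 *: ((f \o shift t) (h *: 1) - f t) @[h --> 0^'] --> l.
  by rewrite -dfl; exact: df.
move=> /cvgrPdist_le/(_ _ e0) [d /= d0 fd].
exists d => // s ts std.
have st0 : 0 < s - t by rewrite subr_gt0.
have := fd (s - t); rewrite /ball_/= sub0r normrN gtr0_norm// => /(_ _ _).
have -> : s - t < d by lra.
move=> /(_ isT); rewrite gt_eqF// => /(_ isT).
rewrite [(s - t) *: 1]mulr1 subrK ler_norml => /andP[H _].
rewrite -ler_pdivrMr// mulrC.
by move: H; rewrite /GRing.scale/=; lra.
Qed.

Lemma scalar_acD a b (f g : R -> R) : scalar_ac a b f -> scalar_ac a b g ->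
  scalar_ac a b (f \+ g).
Proof.
move=> acf acg e e0; have e20 : 0 < e / 2 by rewrite divr_gt0.
have [d1 d10 fd] := acf _ e20; have [d2 d20 gd] := acg _ e20.
exists (Num.min d1 d2); first by rewrite lt_min d10.
move=> m u v uv tI; rewrite lt_min => /andP[/(fd _ _ _ uv tI) h1 /(gd _ _ _ uv tI) h2].
rewrite [ltRHS]splitr; apply: le_lt_trans (ltrD h1 h2); rewrite -big_split/=.
by apply: ler_sum => k _; apply: le_trans (ler_normD _ _); rewrite addrACA -opprD.
Qed.

(** Domination of increments: with [f] the identity it covers Lipschitz functions, with [L = 1]
    negation and truncation from below. *)
Lemma scalar_ac_comp a b (f g : R -> R) (L : R) : scalar_ac a b f ->
  (forall s t, a <= s <= b -> a <= t <= b -> `|g t - g s| <= L * `|f t - f s|) ->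
  scalar_ac a b g.
Proof.
move=> acf gf e e0; have L0 : 0 < `|L| + 1 by rewrite ltr_wpDl.
have [d d0 fd] := acf _ (divr_gt0 e0 L0); exists d => // m u v uv tI /(fd _ _ _ uv tI).
rewrite ltr_pdivlMr//; apply: le_lt_trans; rewrite mulr_suml; apply: ler_sum => k _.
have [au uv' vb] := uv k.
apply: le_trans (gf _ _ _ _) _; rewrite ?au ?vb ?(le_trans uv') ?(le_trans _ uv')//.
by rewrite mulrC ler_wpM2l// (le_trans (ler_norm L))// lerDl.
Qed.

Lemma scalar_acN a b (f : R -> R) : scalar_ac a b f -> scalar_ac a b (\- f).
Proof.
move=> acf; apply: (scalar_ac_comp (L := 1) acf) => s t _ _.
by rewrite -opprD normrN mul1r.
Qed.

Lemma scalar_ac_id (a b : R) : scalar_ac a b idfun.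
Proof.
move=> e e0; exists e => // m u v uv tI.
rewrite [X in _ -> X < _](eq_bigr (fun k => v k - u k))//.
by move=> k _; rewrite ger0_norm// subr_ge0; have [] := uv k.
Qed.

Lemma scalar_ac_lipschitz (a b L : R) (f : R -> R) :
  (forall s t, a <= s <= b -> a <= t <= b -> `|f t - f s| <= L * `|t - s|) ->
  scalar_ac a b f.
Proof. exact: scalar_ac_comp (@scalar_ac_id a b). Qed.

Lemma scalar_ac_sub (a b c d : R) (f : R -> R) : scalar_ac a d f ->
  a <= b -> c <= d -> scalar_ac b c f.
Proof.
move=> acf ab cd e e0; have [r r0 fr] := acf _ e0; exists r => // m u v uv.
apply: fr => k; have [bu ? vc] := uv k.
by split => //; [exact: le_trans bu|exact: le_trans cd].
Qed.

Lemma scalar_ac_le (a b : R) (f g : R -> R) : a <= b ->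
  scalar_ac a b f -> scalar_ac a b g ->
  (\forall t \ae mu, a < t -> t < b -> exists df dg : R,
    [/\ is_derive t (1 : R) f df, is_derive t (1 : R) g dg & df <= dg]) ->
  f b - f a <= g b - g a.
Proof.
move=> ab acf acg fg.
have : (f \+ (\- g)) b <= (f \+ (\- g)) a.
  apply: scalar_ac_nincr => //; first by apply: scalar_acD => //; exact: scalar_acN.
  apply: filterS fg => t H at_ tb; have [df [dg [f't g't le]]] := H at_ tb.
  by apply: (@is_derive_dini _ _ (df + - dg)); rewrite subr_le0.
by rewrite /=; lra.
Qed.

End AbsoluteContinuity.

Section EuclideanNorm.
Context {R : realType} {n : nat}.
Implicit Types x y : 'rV[R]_n.

Lemma enorm_ge0 x : 0 <= enorm x. Proof. exact: sqrtr_ge0. Qed.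

Lemma sqr_enorm x : enorm x ^+ 2 = \sum_(i < n) x ord0 i ^+ 2.
Proof. by rewrite sqr_sqrtr// sumr_ge0// => i _; rewrite sqr_ge0. Qed.

Lemma coord_le_enorm x i : `|x ord0 i| <= enorm x.
Proof.
rewrite -sqrtr_sqr ler_wsqrtr// (bigD1 i)//= lerDl.
by rewrite sumr_ge0// => j _; rewrite sqr_ge0.
Qed.

Lemma coord_le_norm x i : `|x ord0 i| <= `|x|.
Proof.
by rewrite [leRHS]/Num.Def.normr/= mx_normrE; exact: (le_bigmax _ _ (ord0, i)).
Qed.

Lemma norm_le_coord x c : 0 <= c -> (forall i, `|x ord0 i| <= c) -> `|x| <= c.
Proof.
move=> c0 xc; rewrite [leLHS]/Num.Def.normr/= mx_normrE bigmax_le// => -[i j] _.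
by rewrite ord1.
Qed.

Lemma norm_le_enorm x : `|x| <= enorm x.
Proof. by apply: norm_le_coord; [exact: enorm_ge0|exact: coord_le_enorm]. Qed.

(** The crude factor [n], in place of its square root, suffices for every Lipschitz estimate
    below. *)
Lemma enorm_le_norm x : enorm x <= n%:R * `|x|.
Proof.
rewrite -(@ler_pXn2r _ 2)// ?nnegrE ?enorm_ge0 ?mulr_ge0//.
rewrite sqr_enorm exprMn; apply: (@le_trans _ _ (\sum_(i < n) `|x| ^+ 2)).
  apply: ler_sum => i _; rewrite -real_normK ?num_real//.
  by rewrite ler_pXn2r ?nnegrE// coord_le_norm.
rewrite sumr_const card_ord -[leLHS]mulr_natl ler_wpM2r ?sqr_ge0//.
by rewrite -natrX ler_nat; case: (n) => // k; rewrite leq_pmulr.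
Qed.

Lemma abs_continuous_coord a b (z : R -> 'rV[R]_n) i :
  abs_continuous_on a b z -> scalar_ac a b (fun t => z t ord0 i).
Proof.
move=> acz e e0; have [d d0 zd] := acz _ e0; exists d => // m u v uv tI /(zd _ _ _ uv tI).
apply: le_lt_trans; apply: ler_sum => k _.
by apply: le_trans (coord_le_enorm _ i); rewrite !mxE.
Qed.

Lemma abs_continuous_lipschitz a b L (z : R -> 'rV[R]_n) :
  (forall s t, a <= s <= b -> a <= t <= b -> `|z t - z s| <= L * `|t - s|) ->
  abs_continuous_on a b z.
Proof.
move=> zL e e0; have L0 : 0 < n%:R * `|L| + 1 by rewrite ltr_wpDl// mulr_ge0.
have [d d0 fd] := @scalar_ac_id _ a b _ (divr_gt0 e0 L0).
exists d => // m u v uv tI /(fd _ _ _ uv tI).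
rewrite ltr_pdivlMr//; apply: le_lt_trans; rewrite mulr_suml; apply: ler_sum => k _.
have [au uv' vb] := uv k; apply: (le_trans (enorm_le_norm _)).
have := zL (u k) (v k).
rewrite !au !vb (le_trans uv') ?(le_trans _ uv')// => /(_ isT isT) H.
rewrite (@le_trans _ _ (n%:R * (`|L| * `|v k - u k|)))// ?ler_wpM2l//.
  by rewrite (le_trans H)// ler_wpM2r// ler_norm.
by rewrite mulrA mulrC ler_wpM2l// lerDl.
Qed.

Lemma is_derive_coord (z : R -> 'rV[R]_n) (t : R) (l : 'rV[R]_n) :
  is_derive t (1 : R) z l <->
  forall i, is_derive t (1 : R) (fun t => z t ord0 i) (l ord0 i).
Proof.
split=> [[dz zl] i|H].
  by split; [exact: ((derivable_mxP _ _ _).1 dz ord0 i)|rewrite -zl derive_mx// mxE].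
have dz : derivable z t 1.
  by apply/derivable_mxP => i j; rewrite ord1; have [] := H j.
split => //; rewrite derive_mx//; apply/rowP => j; rewrite mxE.
by have [] := H j.
Qed.

Lemma ae_ord (P : 'I_n -> R -> Prop) :
  (forall i, \forall t \ae (@lebesgue_measure R), P i t) ->
  \forall t \ae (@lebesgue_measure R), forall i, P i t.
Proof. by move=> H; exact: filter_forall. Qed.

End EuclideanNorm.

(** * Primitives of bounded measurable functions *)

Section Primitive.
Context {R : realType}.
Local Notation mu := (@lebesgue_measure R).

(** The integral over [[0, x]] is Lipschitz because the integrand is bounded, and the Lebesgue
    differentiation theorem, in the form [FTC1], gives its derivative almost everywhere. *)
Lemma bounded_primitive (e : R -> R) (M : R) : measurable_fun setT e ->
  (forall t, `|e t| <= M) ->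
  exists E : R -> R, [/\ E 0 = 0,
    forall s t : R, 0 <= s -> 0 <= t -> `|E t - E s| <= M * `|t - s| &
    \forall t \ae mu, (0 : R) < t -> is_derive (t : R) (1 : R) E (e t)].
Proof.
move=> me eM.
have be (A : set R) : [bounded e x | x in A].
  exists M; split; first exact: num_real.
  by move=> y My x _ /=; apply: le_trans (eM x) (ltW My).
have ie (A : set R) : measurable A -> (mu A < +oo)%E -> mu.-integrable A (EFin \o e).
  by move=> mA Aoo; apply: measurable_bounded_integrable => //; exact: measurable_funTS.
have iitv (a b : itv_bound R) : (mu [set` Interval a b] < +oo)%E ->
    mu.-integrable [set` Interval a b] (EFin \o e).
  by move=> ?; apply: ie => //; exact: measurable_itv.
have muab (x y : bool) (a b : R) :
    (mu [set` Interval (BSide x a) (BSide y b)] < +oo)%E.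
  by rewrite lebesgue_measure_itv/=; case: ifPn => _; rewrite -?EFinB ?ltry.
pose E x := (\int[mu]_(t in [set` `[0, x]]) (e t))%R.
exists E; split.
- by rewrite /E set_itv1 Rintegral_set1.
- have H s t : 0 <= s -> s <= t -> `|E t - E s| <= M * `|t - s|.
    move=> s0 st; rewrite /E Rintegral_itvB ?bnd_simp//; last first.
      exact: iitv (muab _ _ _ _).
    apply: (le_trans (le_normr_Rintegral _ _)).
    + exact: measurable_itv.
    + exact: iitv (muab _ _ _ _).
    apply: (@le_trans _ _ (\int[mu]_(x in `]s, t]) M)).
      apply: le_Rintegral => //.
      + exact: integrable_norm (iitv _ _ (muab _ _ _ _)).
      + apply: measurable_bounded_integrable => //; first exact: muab.
        exists `|M|; split; first exact: num_real.
        by move=> y /ltW My x _ /=.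
    rewrite Rintegral_cst// [X in fine X]lebesgue_measure_itv/= lte_fin.
    case: ifPn => [st'|_] /=; last by rewrite mulr0 mulr_ge0// (le_trans _ (eM 0)).
    by rewrite ger0_norm// subr_ge0.
  move=> s t s0 t0; have [st|/ltW ts] := leP s t; first exact: H.
  by rewrite distrC [`|t - s|]distrC; exact: H.
- have /(FTC1 (a := BLeft 0)) : locally_integrable setT e.
    split => //; first exact: openT.
    move=> K _ cK; have mK : measurable K by exact: compact_measurable.
    have Koo : (mu K < +oo)%E by exact: compact_finite_measure.
    by have /integrableP[] := ie _ mK Koo.
  move=> H; have := H (fun y => iitv _ _ (muab _ _ _ _)).
  apply: filterS => t /= Ht t0.
  have [dE E't] := Ht t0.
  by split; [exact: dE|rewrite -derive1E].
Qed.

(** Inputs are Lebesgue measurable, whereas primitives are taken of Borel functions. Each superlevel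
    set at a rational level is Borel up to a null Borel set; [f] is set to 0 on the union [N] of
    these countably many null sets and at negative times. *)
Lemma lebesgue_borel (f : R -> R) :
  measurable_fun (`[0, +oo[%classic : set (@lebesgue_type R))
    (f : @lebesgue_type R -> measurableTypeR R) ->
  exists2 g : R -> R, measurable_fun setT g &
    \forall t \ae mu, 0 <= t -> f t = g t.
Proof.
move=> mf.
(* An enumeration of the rationals; a code of no rational gives 0. *)
pose q k : R := if @unpickle rat k is Some x then ratr x else 0.
have qdense (x y : R) : x < y -> exists k, x < q k < y.
  move=> /rat_in_itvoo[r]; rewrite in_itv/= => /andP[xr ry].
  by exists (pickle r); rewrite /q pickleK xr.
have m0 : measurable (`[0, +oo[%classic : set (@lebesgue_type R)).
  apply: sub_sigma_algebra; exists `[0, +oo[%classic; first exact: measurable_itv.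
  by exists set0; [exact: negligible_set0|rewrite setU0].
have /choice[AN ANP] : forall k, exists AN : set R * set R,
    [/\ measurable AN.1, measurable AN.2, mu AN.2 = 0,
     AN.1 `<=` `[0, +oo[ `&` [set t | q k < f t] &
     `[0, +oo[ `&` [set t | q k < f t] `<=` AN.1 `|` AN.2].
  move=> k.
  have mq : measurable (`]q k, +oo[%classic : set (measurableTypeR R)).
    exact: measurable_itv.
  have : (completed_algebra_gen mu).-sigma.-measurable
    (`[0, +oo[ `&` f @^-1` `]q k, +oo[).
    exact: mf m0 _ mq.
  rewrite g_sigma_completed_algebra_genE => -[A mA [N [B [mB B0 NB]]]] AN.
  exists (A, B) => /=; split => //.
    move=> t At; have : (A `|` N) t by left.
    by rewrite AN => -[? /=]; rewrite in_itv/= andbT.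
  move=> t [t0 qf]; have : (A `|` N) t by rewrite AN; split => //=; rewrite in_itv/= qf.
  by case=> [|/NB]; [left|right].
pose N := \bigcup_k (AN k).2.
have mN : measurable N by apply: bigcupT_measurable => k; have [] := ANP k.
have negN : mu.-negligible N.
  apply: negligible_bigcup => k; have [_ ? ? _ _] := ANP k; exact/negligibleP.
exists (fun t => if (0 <= t) && (t \notin N) then f t else 0); last first.
  exists N; split => //; first exact: measure_negligible.
  move=> t /=; apply: contra_notP => tN t0.
  by rewrite ifT// t0/=; apply/negP; rewrite inE.
move=> _; apply: (measurability _ (RGenOInfty.measurableE R)) => //.
move=> _ [_ [x ->] <-]; rewrite setTI.
set g := (g in g @^-1` _).
have -> : g @^-1` `]x, +oo[ = \bigcup_(k in [set k | x < q k]) (g @^-1` `]q k, +oo[).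
  apply/seteqP; split => [t /=|t [k /= xq]]; rewrite !in_itv/= !andbT.
    by move=> /qdense[k /andP[? ?]]; exists k => //=; rewrite in_itv/= andbT.
  exact: lt_trans.
apply: bigcup_measurable => k _.
have [mA mB B0 Asub subA] := ANP k.
(* Negative times and points of [N] carry the default value 0, so they belong to the superlevel set
   exactly when the level is negative. *)
have -> : g @^-1` `]q k, +oo[ = ((AN k).1 `\` N) `|`
    (if q k < 0 then `]-oo, 0[ `|` N else set0).
  apply/seteqP; split => t /=; rewrite in_itv/= andbT /g.
    case: ifPn => [/andP[t0 /negP]|].
      rewrite inE => tN qf; left; split => //.
      have [//|tB] : ((AN k).1 `|` (AN k).2) t.
        by apply: subA; split => //=; rewrite in_itv/= t0.
      by exfalso; apply: tN; exists k.
    rewrite negb_and negbK -ltNge => tt ->; right.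
    by case/orP : tt => [|/set_mem]; [left => /=; rewrite in_itv|right].
  case=> [[/Asub[/=]]|].
    rewrite in_itv/= andbT => t0 qf tN.
    by rewrite ifT// t0/=; apply/negP; rewrite inE.
  case: ifPn => // q0 [|].
    by rewrite /= in_itv/= ltNge => /negbTE ->.
  by move=> /mem_set ->; rewrite andbF.
apply: measurableU; first exact: measurableD.
case: ifPn => // _; apply: measurableU => //; exact: measurable_itv.
Qed.

End Primitive.

(** * Compact sublevel sets and Lipschitz extensions *)

Section Gradient.
Context {R : realType} {n : nat}.
Implicit Types (Z : set 'rV[R]_n) (J h : 'rV[R]_n -> R) (x y z : 'rV[R]_n).

Lemma is_derive_comp_rV J (z : R -> 'rV[R]_n) (t : R) (l : 'rV[R]_n) :
  differentiable J (z t) -> is_derive t (1 : R) z l ->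
  is_derive t (1 : R) (J \o z) (\sum_i partial i J (z t) * l ord0 i).
Proof.
move=> dJ [dz zl]; have dz' : differentiable z t by apply/derivable1_diffP.
have dJz : differentiable (J \o z) t by exact: differentiable_comp.
split; first by apply/derivable1_diffP.
have zl' : 'd z t 1 = l by rewrite -zl deriveE.
rewrite deriveE// diff_comp//= zl' [in LHS](row_sum_delta l).
rewrite linear_sum; apply: eq_bigr => i _.
by rewrite linearZ/= /partial deriveE// mulrC.
Qed.

Lemma ball_rV_convex x (r : R) y z (s : R) : ball x r y -> ball x r z ->
  0 <= s <= 1 -> ball x r (y + s *: (z - y)).
Proof.
rewrite -!ball_normE/= => xy xz /andP[s0 s1].
have -> : x - (y + s *: (z - y)) = (1 - s) *: (x - y) + s *: (x - z).
  by apply/rowP => i; rewrite !mxE; ring.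
apply: (le_lt_trans (ler_normD _ _)).
rewrite !normrZ (ger0_norm s0) ger0_norm ?subr_ge0//.
have [->|sn0] := eqVneq s 0; first by rewrite subr0 mul0r addr0 mul1r.
have sp : 0 < s by rewrite lt0r sn0.
have : s * `|x - z| < s * r by rewrite ltr_pM2l.
have : (1 - s) * `|x - y| <= (1 - s) * r by rewrite ler_wpM2l ?subr_ge0// ltW.
lra.
Qed.

(** Mean value theorem on the segment between the two points, inside a ball where [M] bounds all
    partial derivatives by their continuity at [x]. The factor [n] comes from summing over
    coordinates, each at most the sup norm. *)
Lemma Ck_on_locally_lipschitz Z J x : open Z -> Ck_on 1 Z J -> Z x ->
  exists2 r : R, 0 < r & exists L : R, forall p q,
    ball x r p -> ball x r q -> `|J p - J q| <= L * `|p - q|.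
Proof.
move=> oZ [dJ cJ] Zx; pose M := \sum_i (`|partial i J x| + 1).
have M0 (i : 'I_n) : `|partial i J x| + 1 <= M.
  by rewrite /M (bigD1 i)//= lerDl; apply: sumr_ge0 => j _; rewrite addr_ge0.
have nZ : \forall p \near x, Z p by exact: open_nbhs_nbhs.
have nM : \forall p \near x, forall i, `|partial i J p| <= M.
  apply: (@filter_forall _ _ (fun (i : 'I_n) p => `|partial i J p| <= M) _
    (nbhs_filter x)) => i.
  have /cvgrPdist_lt/(_ _ ltr01) : partial i J p @[p --> x] --> partial i J x.
    exact: (cJ i _ Zx).
  apply: filterS => p xp; apply: le_trans (M0 i).
  rewrite -[partial i J p](subrK (partial i J x)) addrC (le_trans (ler_normD _ _))//.
  by rewrite lerD2l distrC ltW.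
have : \forall p \near x, Z p /\ forall i, `|partial i J p| <= M.
  exact: filterI nZ nM.
move=> /nbhs_ballP[r /= r0 rP]; exists r => //; exists (n%:R * M) => p q xp xq.
pose v := p - q; pose phi (s : R) := J (q + s *: v).
have seg (s : R) : 0 <= s <= 1 -> ball x r (q + s *: v) by exact: ball_rV_convex.
have dphi (s : R) : 0 <= s <= 1 ->
    is_derive s (1 : R) phi (\sum_i partial i J (q + s *: v) * v ord0 i).
  move=> s01; have [Zs _] := rP _ (seg _ s01).
  apply: (@is_derive_comp_rV J (fun s => q + s *: v)); first exact: dJ.
  apply/is_derive_coord => i.
  have dZ : is_derive s (1 : R) (v ord0 i \*: (id : R -> R)) (v ord0 i *: (1 : R)).
    exact: is_deriveZ.
  have := is_deriveD (is_derive_cst (q ord0 i) s (1 : R)) dZ.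
  rewrite add0r [X in is_derive _ _ _ X]mulr1.
  congr (is_derive _ _ _ _); apply/funext => t.
  by rewrite !mxE mulrC.
have [|||c c01] := @MVT_segment _ phi
    (fun s => \sum_i partial i J (q + s *: v) * v ord0 i) 0 1.
- exact: ler01.
- by move=> s; rewrite in_itv/= => /andP[s0 s1]; apply: dphi; rewrite !ltW.
- apply: derivable_within_continuous => s; rewrite in_itv/= => s01.
  by have [] := dphi _ s01.
rewrite subr0 mulr1 /phi scale1r scale0r addr0 [q + v]addrC subrK => ->.
have [_ Hc] : Z (q + c *: v) /\ forall i, `|partial i J (q + c *: v)| <= M.
  by apply/rP/seg; move: c01; rewrite in_itv.
apply: le_trans (ler_norm_sum _ _ _) _.
apply: (@le_trans _ _ (\sum_(i < n) M * `|p - q|)); last first.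
  by rewrite sumr_const card_ord -[leLHS]mulr_natl mulrA.
apply: ler_sum => i _; rewrite normrM ler_pM//; last exact: coord_le_norm.
Qed.

(** A single [N] serves as bound, Lipschitz constant and inverse radius. Near each point of [K] all
    large [N] work, so compactness applies to the filter at infinity. The point [q] ranges over the
    whole space, as is needed for pairs that straddle the border of [K]. *)
Lemma locally_lipschitz_compact (X : normedModType R) (F : X -> R) (K : set X) :
  compact K ->
  (forall x : X, K x -> exists2 r : R, 0 < r & exists L : R, forall p q,
    ball x r p -> ball x r q -> `|F p - F q| <= L * `|p - q|) ->
  exists2 N : R, 0 < N & forall x : X, K x -> `|F x| <= N /\
    forall q, `|x - q| < N^-1 -> `|F x - F q| <= N * `|x - q|.
Proof.
move=> /compact_near_coveringP cK FK.
pose P (N : R) (x : X) := 0 < N /\ (`|F x| <= N /\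
    forall q, `|x - q| < N^-1 -> `|F x - F q| <= N * `|x - q|).
have : \forall N \near +oo, K `<=` P N.
  apply: cK => /= x Kx; have [r r0 [L FL]] := FK x Kx.
  (* The four terms ensure positivity, the Lipschitz constant, an inverse below [r / 2], and the
     bound on the values in the ball. *)
  pose N0 := Num.max 1 (Num.max `|L| (Num.max (2 / r) (`|F x| + `|L| * r))).
  exists (ball x (r / 2), [set N : R | N0 < N]) => /=.
    split; first exact: nbhsx_ballx (divr_gt0 _ _).
    by exists N0; split; rewrite ?num_real.
  move=> [y N] /= [xy]; rewrite /N0 !gt_max => /and4P[N1 LN rN FN].
  have Np : 0 < N by exact: lt_trans N1.
  have xy' : ball x r y by apply: le_ball xy; lra.
  split => //; split.
    rewrite -[F y](subrK (F x)) addrC (le_trans (ler_normD _ _))//.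
    rewrite (le_trans _ (ltW FN))//.
    rewrite lerD2l (le_trans (FL _ _ xy' (ballxx _ r0)))//.
    rewrite (le_trans (ler_wpM2r _ (ler_norm L)))// ler_wpM2l//.
    by move: xy'; rewrite -ball_normE/= distrC => /ltW.
  move=> q yq; have xq : ball x r q.
    rewrite (splitr r); apply: (ball_triangle xy); rewrite -ball_normE/=.
    apply: (lt_le_trans yq); rewrite -[leRHS]invrK lef_pV2 ?posrE ?invr_gt0 ?divr_gt0//.
    by rewrite invf_div ltW.
  apply: (le_trans (FL _ _ xy' xq)); rewrite ler_wpM2r//.
  by rewrite (le_trans (ler_norm L))// ltW.
move=> [M [_ HM]]; exists (`|M| + 1); first by rewrite ltr_wpDl.
have MM : M < `|M| + 1 by rewrite (le_lt_trans (ler_norm M))// ltrDl.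
by move=> x /(HM _ MM)[].
Qed.

Section Sublevel.
Variables (Z : set 'rV[R]_n) (zstar : 'rV[R]_n) (V : 'rV[R]_n -> R).
Hypotheses (oZ : open Z) (sV : size_function Z zstar V).

Lemma cvg_bounded_pinfty (u : nat -> R) c : (forall k, u k <= c) ->
  ~ (u k @[k --> \oo] --> +oo).
Proof.
move=> uc /cvgryPgt/(_ c) [N _ /(_ N (leqnn N))] /=.
by rewrite ltNge uc.
Qed.

(** Coercivity acts twice: an unbounded sequence in the sublevel set, or one converging to a point
    outside [Z] (hence on the boundary), would force [V] to infinity although it is at most [c]. *)
Lemma sublevel_compact (c : R) : compact [set z | Z z /\ V z <= c].
Proof.
apply: bounded_closed_compact.
  suff [M HM] : exists M : R, forall z, Z z /\ V z <= c -> `|z| <= M.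
    exists M; split; first exact: num_real.
    by move=> x Mx z /HM /le_trans; apply; exact: ltW.
  apply: contrapT => /forallNP noM.
  have /choice[u Hu] : forall k : nat, exists z, (Z z /\ V z <= c) /\ k%:R < `|z|.
    move=> k; have /existsNP[z /not_implyP[Sz /negP]] := noM k%:R.
    by rewrite -ltNge => kz; exists z.
  apply: (@cvg_bounded_pinfty (V \o u) c); first by move=> k; have [[]] := Hu k.
  apply: (size_coercive sV); first by move=> k; have [[]] := Hu k.
  right; apply/cvgryPge => A.
  have := @cvgr_idn R => /cvgryPge/(_ A); apply: filterS => k Ak.
  apply: le_trans Ak _; apply: le_trans (norm_le_enorm _).
  by have [_ /ltW] := Hu k.
move=> w Sw.
have /choice[u Hu] : forall k : nat, exists z,
    (Z z /\ V z <= c) /\ `|w - z| < k.+1%:R^-1.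
  move=> k; have [|z [Sz]] := Sw (ball w k.+1%:R^-1).
    by apply: nbhsx_ballx; rewrite invr_gt0.
  by rewrite -ball_normE => wz; exists z.
have uw : u k @[k --> \oo] --> w.
  apply/cvgrPdist_lt => e e0; near=> k; apply: lt_trans (Hu k).2 _.
  by near: k; exact: near_infty_natSinv_lt (PosNum e0).
have [Zw|nZw] := pselect (Z w).
  split => //.
  have cV : {for w, continuous V}.
    have := size_continuous sV; rewrite continuous_open_subspace//.
    by move=> /(_ w); apply; rewrite inE.
  have : (V \o u) k @[k --> \oo] --> V w.
    exact: (cvg_comp _ _ uw).
  move=> Vu; apply: (@cvgr_to_le _ _ _ _ _ _ _ Vu).
  by apply: nearW => k /=; have [[]] := Hu k.
exfalso; apply: (@cvg_bounded_pinfty (V \o u) c); first by move=> k; have [[]] := Hu k.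
apply: (size_coercive sV); first by move=> k; have [[]] := Hu k.
left => e e0.
have n0 : 0 < n%:R + 1 :> R by rewrite ltr_wpDl.
have /cvgrPdist_lt/(_ _ (divr_gt0 e0 n0)) := uw.
apply: filterS => k wu; exists w; split.
  split; last by move=> /interior_subset.
  by move=> B /Sw[z [[Zz _] Bz]]; exists z.
apply: (le_lt_trans (enorm_le_norm _)); rewrite distrC.
apply: (@le_lt_trans _ _ ((n%:R + 1) * `|w - u k|)); first by rewrite ler_wpM2r// lerDl.
by rewrite mulrC -ltr_pdivlMr.
Unshelve. all: by end_near. Qed.

End Sublevel.
End Gradient.

Section Cutoff.
Context {R : realType} {n : nat}.
Variables (Z : set 'rV[R]_n) (zstar : 'rV[R]_n) (J : 'rV[R]_n -> R).
Hypotheses (oZ : open Z) (sJ : size_function Z zstar (fun z => J z - J zstar)).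
Hypothesis cJ : Ck_on 1 Z J.

(** The extension is [h] times a cutoff [chi] of the energy, equal to 1 up to level [c] and to 0
    from level [c + 1] on. It vanishes outside a compact sublevel set, so its local Lipschitz bounds
    become a global one. *)
Lemma lipschitz_extension (h : 'rV[R]_n -> R) (c : R) : Ck_on 1 Z h ->
  exists (g : 'rV[R]_n -> R) (L : R), [/\ 0 < L,
    forall x y, `|g x - g y| <= L * `|x - y|,
    forall x, `|g x| <= L &
    forall x, Z x -> J x - J zstar <= c -> g x = h x].
Proof.
move=> ch; pose chi (w : R) := Num.max 0 (Num.min 1 (c + 1 - w)).
pose g x := if x \in Z then chi (J x - J zstar) * h x else 0.
pose K := [set z | Z z /\ J z - J zstar <= c + 1].
have chi0 w : 0 <= chi w by rewrite le_max lexx.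
have chi1 w : chi w <= 1 by rewrite ge_max ler01/= ge_min lexx.
have chiL v w : `|chi v - chi w| <= `|v - w|.
  rewrite /chi /Num.max /Num.min; case: ifP; case: ifP; case: ifP; case: ifP;
    rewrite ?ltNge => *; rewrite !ler_norml; apply/andP; split;
    have := ler_norm (v - w); have := ler_norm (w - v); rewrite distrC; lra.
have gK x : ~ K x -> g x = 0.
  move=> nK; rewrite /g; case: ifPn => // /set_mem Zx.
  have : ~ (J x - J zstar <= c + 1) by move=> H; exact: nK.
  move=> /negP; rewrite -ltNge => H.
  rewrite /chi (_ : Num.max _ _ = 0) ?mul0r//.
  by apply/max_idPl; rewrite ge_min; apply/orP; right; lra.
have locg x : K x -> exists2 r : R, 0 < r & exists L : R, forall p q,
    ball x r p -> ball x r q -> `|g p - g q| <= L * `|p - q|.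
  move=> [Zx _]; have [r1 r10 [L1 H1]] := Ck_on_locally_lipschitz oZ cJ Zx.
  have [r2 r20 [L2 H2]] := Ck_on_locally_lipschitz oZ ch Zx.
  have /nbhs_ballP[r3 /= r30 H3] : nbhs x Z by exact: open_nbhs_nbhs.
  pose r := Num.min r1 (Num.min r2 r3).
  have rr1 : r <= r1 by rewrite ge_min lexx.
  have rr2 : r <= r2 by rewrite !ge_min lexx orbT.
  have rr3 : r <= r3 by rewrite !ge_min lexx !orbT.
  have r0 : 0 < r by rewrite !lt_min r10 r20.
  exists r => //; exists (`|L1| * (`|h x| + `|L2| * r) + `|L2|) => p q xp xq.
  have Zp : Z p by apply/H3/(le_ball rr3).
  have Zq : Z q by apply/H3/(le_ball rr3).
  rewrite /g !mem_set//.
  have hp : `|h p| <= `|h x| + `|L2| * r.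
    rewrite -[h p](subrK (h x)) addrC (le_trans (ler_normD _ _))// lerD2l.
    rewrite (le_trans (H2 _ _ (le_ball rr2 xp) (ballxx _ r20)))//.
    rewrite (le_trans (ler_wpM2r _ (ler_norm L2)))// ler_wpM2l//.
    by move: xp; rewrite -ball_normE/= distrC => /ltW.
  have E1 := le_trans (H1 p q (le_ball rr1 xp) (le_ball rr1 xq))
    (ler_wpM2r (normr_ge0 _) (ler_norm L1)).
  have E2 := le_trans (H2 p q (le_ball rr2 xp) (le_ball rr2 xq))
    (ler_wpM2r (normr_ge0 _) (ler_norm L2)).
  set A := chi (J p - _); set B := chi (J q - _).
  have -> : A * h p - B * h q = (A - B) * h p + B * (h p - h q) by ring.
  apply: (le_trans (ler_normD _ _)); rewrite !normrM mulrDl; apply: lerD; last first.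
    rewrite (ger0_norm (chi0 _)) -[leRHS]mul1r; apply: ler_pM => //.
  rewrite -mulrAC; apply: ler_pM => //.
  by apply: le_trans (chiL _ _) _; rewrite (_ : J p - J zstar - _ = J p - J q)//; ring.
have [N N0 HN] := locally_lipschitz_compact (sublevel_compact oZ sJ (c := c + 1)) locg.
have gN x : `|g x| <= N.
  by have [/HN[]//|/gK ->] := pselect (K x); rewrite normr0 ltW.
exists g, (Num.max N (2 * N ^+ 2)); split.
- by rewrite lt_max N0.
(* Off [K] the function is 0, so one of the two points may be taken in [K]. *)
- suff H x y : K x -> `|g x - g y| <= Num.max N (2 * N ^+ 2) * `|x - y|.
    move=> x y; have [/H//|/gK gx] := pselect (K x).
    have [/H Ky|/gK gy] := pselect (K y).
      by rewrite distrC [`|x - y|]distrC.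
    by rewrite gx gy subrr normr0 mulr_ge0// le_max ltW.
  (* At distance less than [N^-1] the bound near [K] applies. Otherwise the difference is at most
     [2 * N], and [N] times the distance is at least 1, whence the constant [2 * N ^+ 2]. *)
  move=> Kx; have [xy|xy] := ltP `|x - y| N^-1.
    apply: (le_trans ((HN _ Kx).2 _ xy)); rewrite ler_wpM2r//.
    by rewrite le_max lexx.
  apply: (@le_trans _ _ (2 * N ^+ 2 * `|x - y|)); last first.
    by rewrite ler_wpM2r// le_max lexx orbT.
  apply: (@le_trans _ _ (2 * N)).
    by apply: (le_trans (ler_normB _ _)); have := gN x; have := gN y; lra.
  have N1 : 1 <= N * `|x - y| by rewrite -ler_pdivrMl// mulr1.
  have -> : 2 * N ^+ 2 * `|x - y| = 2 * N * (N * `|x - y|) by ring.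
  by rewrite ler_peMr// mulr_ge0// ltW.
- by move=> x; rewrite (le_trans (gN x))// le_max lexx.
- move=> x Zx xc; rewrite /g mem_set// /chi (_ : Num.max _ _ = 1) ?mul1r//.
  rewrite (min_idPl _) ?(max_idPr _) //; lra.
Qed.

Lemma lipschitz_extension_rV (G : 'rV[R]_n -> 'rV[R]_n) (c : R) :
  (forall i, Ck_on 1 Z (fun x => G x ord0 i)) ->
  exists (F : 'rV[R]_n -> 'rV[R]_n) (L : R), [/\ 0 < L,
    forall x y, `|F x - F y| <= L * `|x - y|,
    forall x, `|F x| <= L &
    forall x, Z x -> J x - J zstar <= c -> F x = G x].
Proof.
move=> cG.
have /choice[g Hg] : forall i, exists gL : ('rV[R]_n -> R) * R, [/\ 0 < gL.2,
    forall x y, `|gL.1 x - gL.1 y| <= gL.2 * `|x - y|,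
    forall x, `|gL.1 x| <= gL.2 &
    forall x, Z x -> J x - J zstar <= c -> gL.1 x = G x ord0 i].
  by move=> i; have [g [L H]] := lipschitz_extension c (cG i); exists (g, L).
(* The summand 1 keeps [L] positive in dimension 0. *)
pose L := 1 + \sum_i (g i).2.
have S0 : 0 <= \sum_i (g i).2 by apply: sumr_ge0 => i _; have [/ltW] := Hg i.
have L0 : 0 < L by rewrite ltr_wpDr.
have gL i : (g i).2 <= L.
  rewrite /L (bigD1 i)//= addrCA lerDl addr_ge0//.
  by apply: sumr_ge0 => j _; have [/ltW] := Hg j.
exists (fun x => \row_i (g i).1 x), L; split => //.
- move=> x y; apply: norm_le_coord; first by rewrite mulr_ge0// ltW.
  move=> i; rewrite !mxE; have [_ H _ _] := Hg i.
  by apply: (le_trans (H _ _)); rewrite ler_wpM2r.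
- move=> x; apply: norm_le_coord; first exact: ltW.
  by move=> i; rewrite !mxE; have [_ _ H _] := Hg i; exact: le_trans (gL i).
- by move=> x Zx xc; apply/rowP => i; rewrite mxE; have [_ _ _ ->] := Hg i.
Qed.

End Cutoff.

(** * Differential equations with a globally Lipschitz field *)

Section Growth.
Context {R : realType} {n : nat}.
Local Notation mu := (@lebesgue_measure R).
Implicit Types (z : R -> 'rV[R]_n) (F : 'rV[R]_n -> 'rV[R]_n).

Lemma expR_lipschitz (B x y : R) : x <= B -> y <= B ->
  `|expR x - expR y| <= expR B * `|x - y|.
Proof.
wlog yx : x y / y <= x => [H xB yB|xB yB].
  have [yx|/ltW xy] := leP y x; first exact: H.
  by rewrite distrC [`|x - y|]distrC; exact: H.
rewrite !ger0_norm ?subr_ge0 ?ler_expR//.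
have -> : expR x - expR y = expR x * (1 - expR (y - x)).
  by rewrite mulrBr mulr1 -expRD [x + _]addrC subrK.
apply: ler_pM; rewrite ?expR_ge0 ?ler_expR//.
  by rewrite subr_ge0 -expR0 ler_expR subr_le0.
by have := expR_ge1Dx (y - x); lra.
Qed.

(* The weight [expR (2 * L * t)] turns the Lipschitz constant [L] into the
   contraction factor [1 / 2]. *)
Lemma weighted_growth (u : R -> 'rV[R]_n) (b L C : R) : 0 <= b -> 0 < L -> 0 <= C ->
  (forall i, scalar_ac 0 b (fun t => u t ord0 i)) -> u 0 = 0 ->
  (\forall t \ae mu, 0 < t -> t < b -> exists2 l,
     is_derive t (1 : R) u l & `|l| <= L * (C * expR (2 * L * t))) ->
  `|u b| <= C / 2 * expR (2 * L * b).
Proof.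
move=> b0 L0 C0 acu u0 du.
pose g (t : R) := C / 2 * expR (2 * L * t).
have L20 : 0 <= 2 * L by rewrite mulr_ge0// ltW.
have acg : scalar_ac 0 b g.
  apply: (@scalar_ac_lipschitz _ _ _ (C / 2 * (expR (2 * L * b) * (2 * L)))).
  move=> s t /andP[s0 sb] /andP[t0 tb].
  rewrite /g -mulrBr normrM (ger0_norm (divr_ge0 _ _))// -[leRHS]mulrA.
  apply: ler_wpM2l; first exact: divr_ge0.
  apply: le_trans (expR_lipschitz (B := 2 * L * b) _ _) _.
  - exact: ler_wpM2l.
  - exact: ler_wpM2l.
  - by rewrite -mulrBr normrM (ger0_norm L20) !mulrA.
have dg (t : R) : is_derive t (1 : R) g (L * (C * expR (2 * L * t))).
  have dZ : is_derive t (1 : R) ((2 * L) \*: (id : R -> R)) ((2 * L) *: (1 : R)).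
    exact: is_deriveZ.
  have dE := is_derive1_comp (is_derive_expR _) dZ.
  have := is_deriveZ (C / 2) dE; congr (is_derive _ _ _ _).
  rewrite /GRing.scale/=; by field.
have gb : g b - g 0 <= g b by rewrite gerBl /g mulr_ge0 ?divr_ge0// expR_ge0.
apply: norm_le_coord; first by rewrite mulr_ge0 ?divr_ge0// expR_ge0.
move=> i; rewrite ler_norml; apply/andP; split.
- rewrite lerNl; apply: le_trans gb.
  have := @scalar_ac_le _ 0 b (fun t => - u t ord0 i) g b0.
  rewrite u0 mxE oppr0 subr0; apply => //; first exact: scalar_acN.
  apply: filterS du => t H t0 tb; have [l dl lL] := H t0 tb.
  exists (- l ord0 i), (L * (C * expR (2 * L * t))); split => //.
    by apply: is_deriveN; exact: (is_derive_coord _ _ _).1.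
  by apply: le_trans lL; rewrite (le_trans (ler_norm _))// normrN coord_le_norm.
- apply: le_trans gb.
  have := @scalar_ac_le _ 0 b (fun t => u t ord0 i) g b0.
  rewrite u0 mxE subr0; apply => //.
  apply: filterS du => t H t0 tb; have [l dl lL] := H t0 tb.
  exists (l ord0 i), (L * (C * expR (2 * L * t))); split => //.
    exact: (is_derive_coord _ _ _).1.
  by apply: le_trans lL; rewrite (le_trans (ler_norm _)) ?coord_le_norm//.
Qed.

Lemma geometric_eq0 (a C : R) : (forall k : nat, a <= C * 2^-1 ^+ k) -> a <= 0.
Proof.
move=> H.
have : (fun k => C * 2^-1 ^+ k) k @[k --> \oo] --> C * 0.
  apply: cvgMl_tmp; apply: cvg_expr; rewrite ger0_norm; lra.
rewrite mulr0 => cv; apply: (@cvgr_to_ge _ _ _ _ _ _ _ cv).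
exact: nearW.
Qed.

(** Each use of [weighted_growth] halves the weighted bound on the distance of the two curves, which
    is therefore 0. Boundedness of [F] provides the first bound. *)
Lemma lipschitz_unique F (e : R -> 'rV[R]_n) (L b : R) z1 z2 : 0 < L ->
  (forall x y, `|F x - F y| <= L * `|x - y|) -> (forall x, `|F x| <= L) ->
  (forall i, scalar_ac 0 b (fun t => z1 t ord0 i)) ->
  (forall i, scalar_ac 0 b (fun t => z2 t ord0 i)) -> z1 0 = z2 0 ->
  (\forall t \ae mu, 0 < t -> t < b -> is_derive t (1 : R) z1 (F (z1 t) + e t)) ->
  (\forall t \ae mu, 0 < t -> t < b -> is_derive t (1 : R) z2 (F (z2 t) + e t)) ->
  forall t, 0 <= t <= b -> z1 t = z2 t.
Proof.
move=> L0 FL FM ac1 ac2 z0 d1 d2.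
suff H k : forall t, 0 <= t <= b -> `|z1 t - z2 t| <= 2 * 2^-1 ^+ k * expR (2 * L * t).
  move=> t tb; apply/eqP; rewrite -subr_eq0 -normr_le0.
  apply: (@geometric_eq0 _ (2 * expR (2 * L * t))) => k.
  by rewrite mulrAC; exact: H.
have E0 (t : R) : 0 <= t -> 1 <= expR (2 * L * t).
  by move=> t0; rewrite -expR0 ler_expR mulr_ge0// mulr_ge0// ltW.
have base C : 0 <= C ->
    (forall t, 0 <= t <= b -> `|F (z1 t) - F (z2 t)| <= L * (C * expR (2 * L * t))) ->
    forall t, 0 <= t <= b -> `|z1 t - z2 t| <= C / 2 * expR (2 * L * t).
  move=> C0 HC t /andP[t0 tb].
  apply: (@weighted_growth (z1 - z2)) => //.
  - move=> i.
    rewrite (_ : (fun t => _) = (fun t => z1 t ord0 i) \+ (\- (fun t => z2 t ord0 i))).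
      by apply: scalar_acD; [|apply: scalar_acN]; apply: scalar_ac_sub tb; eauto.
    by apply/funext => s; rewrite !mxE.
  - by rewrite /= -[LHS]/(z1 0 - z2 0) z0 subrr.
  - apply: filterS2 d1 d2 => s H1 H2 s0 st; have sb := lt_le_trans st tb.
    exists (F (z1 s) + e s - (F (z2 s) + e s)).
      by apply: is_deriveB; [exact: H1|exact: H2].
    by rewrite opprD addrACA subrr addr0; apply: HC; rewrite !ltW.
elim: k => [|k IH] t tb.
  have -> : 2 * 2^-1 ^+ 0 = 4 / 2 :> R by rewrite expr0; lra.
  apply: base => // s /andP[s0 sb].
  apply: (le_trans (ler_normB _ _)).
  have := FM (z1 s); have := FM (z2 s); have : L * 1 <= L * expR (2 * L * s).
    by rewrite ler_pM2l// E0.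
  rewrite mulrCA; lra.
have -> : 2 * 2^-1 ^+ k.+1 = (2 * 2^-1 ^+ k) / 2 :> R by rewrite exprS; field.
apply: base => //.
move=> s sb; apply: (le_trans (FL _ _)); rewrite ler_pM2l//; exact: IH.
Qed.

End Growth.

Section Picard.
Context {R : realType} {n : nat}.
Local Notation mu := (@lebesgue_measure R).
Implicit Types (z : R -> 'rV[R]_n) (F : 'rV[R]_n -> 'rV[R]_n).

Lemma continuous_of_lipschitz (V : normedModType R) (f : R -> V) (K : R) :
  (forall s t, `|f t - f s| <= K * `|t - s|) -> continuous f.
Proof.
move=> fK t; apply/cvgrPdist_lt => e e0.
have K0 : 0 < `|K| + 1 by rewrite ltr_wpDl.
have /cvgrPdist_lt/(_ _ (divr_gt0 e0 K0)) : s @[s --> t] --> t by exact: cvg_id.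
apply: filterS => s; rewrite ltr_pdivlMr// => ts; apply: le_lt_trans ts.
apply: (le_trans (fK _ _)); rewrite mulrC ler_wpM2l//.
by rewrite (le_trans (ler_norm K))// lerDl.
Qed.

Lemma primitive_rV (w : R -> 'rV[R]_n) (M : R) :
  (forall i, measurable_fun setT (fun t => w t ord0 i)) ->
  (forall t, `|w t| <= M) ->
  exists E : R -> 'rV[R]_n, [/\ E 0 = 0,
    forall s t : R, `|E t - E s| <= M * `|t - s| &
    \forall t \ae mu, (0 : R) < t -> is_derive (t : R) (1 : R) E (w t)].
Proof.
move=> mw wM; have M0 : 0 <= M by apply: le_trans (wM 0).
have /choice[E HE] : forall i, exists E : R -> R, [/\ E 0 = 0,
    forall s t : R, 0 <= s -> 0 <= t -> `|E t - E s| <= M * `|t - s| &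
    \forall t \ae mu, (0 : R) < t -> is_derive (t : R) (1 : R) E (w t ord0 i)].
  move=> i; apply: bounded_primitive => // t.
  exact: le_trans (coord_le_norm _ _) (wM t).
(* Clamping time at 0 makes the primitive Lipschitz on the whole line and changes nothing near a
   positive time. *)
exists (fun t => \row_i E i (Num.max 0 t)); split.
- by apply/rowP => i; rewrite !mxE maxxx; have [-> _ _] := HE i.
- move=> s t; apply: norm_le_coord; first by rewrite mulr_ge0.
  move=> i; rewrite !mxE; have [_ H _] := HE i.
  apply: le_trans (H _ _ _ _) _; rewrite ?le_max ?lexx//.
  by rewrite ler_wpM2l// maxr_lipschitz.
- have : \forall t \ae mu, forall i, (0 : R) < t ->
      is_derive (t : R) (1 : R) (E i) (w t ord0 i).
    by apply: ae_ord => i; have [_ _] := HE i.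
  apply: filterS => t Ht t0; apply/is_derive_coord => i.
  apply: near_eq_is_derive (Ht i t0).
  have : \forall s \near t, 0 < s by exact: lt_nbhsr.
  by apply: filterS => s s0; rewrite mxE (max_idPr (ltW s0)).
Qed.

Lemma ler_lim_dist (u : nat -> 'rV[R]_n) (l a : 'rV[R]_n) (c : R) :
  u k @[k --> \oo] --> l -> (\forall k \near \oo, `|u k - a| <= c) -> `|l - a| <= c.
Proof.
move=> ul uc.
have : `|u k - a| @[k --> \oo] --> `|l - a|.
  by apply: cvg_norm; apply: cvgB => //; exact: cvg_cst.
by move=> /cvgr_to_le; apply.
Qed.

Lemma geometric_cvg (u : nat -> 'rV[R]_n) (C : R) : 0 <= C ->
  (forall k, `|u k.+1 - u k| <= C / 2 * 2^-1 ^+ k) ->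
  exists l : 'rV[R]_n, u k @[k --> \oo] --> l /\ forall k, `|l - u k| <= C * 2^-1 ^+ k.
Proof.
move=> C0 uC.
have p0 k : 0 <= C * 2^-1 ^+ k by rewrite mulr_ge0// exprn_ge0// invr_ge0.
have H k m : `|u (m + k)%N - u k| <= C * 2^-1 ^+ k - C * 2^-1 ^+ (m + k).
  elim: m => [|m IH]; first by rewrite add0n !subrr normr0.
  rewrite addSn -(subrKA (u (m + k)%N)).
  apply: (le_trans (ler_normD _ _)); have := uC (m + k)%N.
  move: IH; rewrite exprS; set X := 2^-1 ^+ (m + k); lra.
have H' k m : (k <= m)%N -> `|u m - u k| <= C * 2^-1 ^+ k.
  by move=> /subnK <-; apply: (le_trans (H _ _)); rewrite gerBl.
have C20 : (fun k => C * 2^-1 ^+ k) k @[k --> \oo] --> 0.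
  by rewrite -(mulr0 C); apply: cvgMl_tmp; apply: cvg_expr; rewrite ger0_norm; lra.
have : cvg (u k @[k --> \oo]).
  apply: cauchy_cvg; apply: cauchy_exP => e e0.
  move/cvgrPdist_lt : C20 => /(_ _ e0) [N _ HN]; exists (u N).
  exists N => // k /= Nk; rewrite /= -ball_normE/= distrC.
  apply: le_lt_trans (H' _ _ Nk) _.
  by have := HN N (leqnn N); rewrite /= sub0r normrN ger0_norm.
move=> /cvg_ex[l ul]; exists l; split => // k.
by apply: (ler_lim_dist ul); exists k => // m /= /H'.
Qed.

(** The limit [z] of the iterates is again Lipschitz, so [step] applies to it; the contraction
    estimate then shows that [step z] equals [z] at nonnegative times. No limit is taken under a
    derivative. *)
Lemma picard F (e : R -> 'rV[R]_n) (L D : R) (z0 : 'rV[R]_n) : 0 < L ->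
  (forall x y, `|F x - F y| <= L * `|x - y|) -> (forall x, `|F x| <= L) ->
  (forall i, measurable_fun setT (fun t => e t ord0 i)) ->
  (forall t, `|e t| <= D) ->
  exists z : R -> 'rV[R]_n, [/\ z 0 = z0,
    forall s t, `|z t - z s| <= (L + D) * `|t - s| &
    \forall t \ae mu, (0 : R) < t -> is_derive (t : R) (1 : R) z (F (z t) + e t)].
Proof.
move=> L0 FL FM me eD; pose K := L + D.
have D0 : 0 <= D by apply: le_trans (eD 0).
have K0 : 0 <= K by rewrite addr_ge0// ltW.
pose lip z := forall s t, `|z t - z s| <= K * `|t - s|.
pose sol z z' := z' 0 = z0 /\ \forall t \ae mu, (0 : R) < t ->
  is_derive (t : R) (1 : R) z' (F (z t) + e t).
(* Only Lipschitz curves matter: their composite with [F] is continuous, hence measurable. *)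
have /choice[step Hstep] : forall z, exists z', lip z -> lip z' /\ sol z z'.
  move=> z; have [zl|nz] := pselect (lip z); last by exists z.
  have [||E [E0 EL dE]] := @primitive_rV (fun t => F (z t) + e t) K.
  - move=> i.
    rewrite (_ : (fun t => _) =
      (fun t => F (z t) ord0 i) \+ (fun t => e t ord0 i)); last first.
      by apply/funext => t; rewrite mxE.
    apply: measurable_funD => //; apply: continuous_measurable_fun.
    apply: (@continuous_of_lipschitz _ _ (L * K)) => s t.
    rewrite (le_trans _ (le_trans (FL (z t) (z s)) _))//.
      by apply: le_trans (coord_le_norm _ i); rewrite !mxE.
    by rewrite -mulrA ler_wpM2l// ltW.
  - by move=> t; apply: (le_trans (ler_normD _ _)); exact: lerD.
  exists (fun t => z0 + E t) => _; split; [|split].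
  - by move=> s t; rewrite opprD addrACA subrr add0r.
  - by rewrite E0 addr0.
  - apply: filterS dE => t dE t0.
    have := is_deriveD (is_derive_cst z0 t (1 : R)) (dE t0).
    by rewrite add0r.
pose zs k := iter k step (cst z0).
have lipzs k : lip (zs k).
  elim: k => [|k /Hstep[]//] s t.
  by rewrite subrr normr0 mulr_ge0.
have solzs k : sol (zs k) (zs k.+1) by have [_] := Hstep _ (lipzs k).
have lip_ac z b i : lip z -> scalar_ac 0 b (fun t => z t ord0 i).
  move=> zl; apply: (scalar_ac_lipschitz (L := K)) => s t _ _.
  by apply: le_trans (zl s t); apply: le_trans (coord_le_norm _ i); rewrite !mxE.
have contr (C : R) z1 z2 w1 w2 : 0 <= C -> lip w1 -> lip w2 -> sol z1 w1 -> sol z2 w2 ->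
    (forall t, 0 <= t -> `|F (z1 t) - F (z2 t)| <= L * (C * expR (2 * L * t))) ->
    forall t, 0 <= t -> `|w1 t - w2 t| <= C / 2 * expR (2 * L * t).
  move=> C0 l1 l2 [s1 d1] [s2 d2] HC t t0.
  apply: (@weighted_growth _ _ (w1 - w2)) => //.
  - move=> i.
    rewrite (_ : (fun t => _) = (fun t => w1 t ord0 i) \+ (\- (fun t => w2 t ord0 i))).
      by apply: scalar_acD; [|apply: scalar_acN]; exact: lip_ac.
    by apply/funext => s; rewrite !mxE.
  - by rewrite -[LHS]/(w1 0 - w2 0) s1 s2 subrr.
  - apply: filterS2 d1 d2 => s H1 H2 sp st.
    exists (F (z1 s) + e s - (F (z2 s) + e s)).
      by apply: is_deriveB; [exact: H1|exact: H2].
    by rewrite opprD addrACA subrr addr0; apply: HC; exact: ltW.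
pose A t : R := 2 * expR (2 * L * t).
have A0 t : 0 <= A t by rewrite mulr_ge0// expR_ge0.
have E1 (t : R) : 0 <= t -> 1 <= expR (2 * L * t).
  by move=> t0; rewrite -expR0 ler_expR mulr_ge0// mulr_ge0// ltW.
(* The indices start at 1 because [contr] compares two outputs of [step], and the constant curve
   [zs 0] is not obtained as one. *)
have zsA k t : 0 <= t -> `|zs k.+2 t - zs k.+1 t| <= A t / 2 * 2^-1 ^+ k.
  have -> : A t / 2 * 2^-1 ^+ k = 2 * 2^-1 ^+ k / 2 * expR (2 * L * t).
    by rewrite /A; field.
  elim: k t => [|k IH] t t0.
    apply: contr (lipzs _) (lipzs _) (solzs _) (solzs _) _ _ t0; first by rewrite expr0.
    move=> s s0; apply: (le_trans (ler_normB _ _)).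
    have := FM (zs 1%N s); have := FM (zs 0%N s); have : L * 1 <= L * expR (2 * L * s).
      by rewrite ler_pM2l// E1.
    rewrite expr0; lra.
  have p0 : 0 <= 2 * 2^-1 ^+ k.+1 :> R by rewrite mulr_ge0// exprn_ge0// invr_ge0.
  apply: contr p0 (lipzs _) (lipzs _) (solzs _) (solzs _) _ _ t0.
  move=> s s0; apply: (le_trans (FL _ _)); rewrite ler_pM2l//.
  by apply: (le_trans (IH _ s0)); rewrite exprS; lra.
have /choice[zl Hzl] : forall t, exists l : 'rV[R]_n, 0 <= t ->
    zs k.+1 t @[k --> \oo] --> l /\ forall k, `|l - zs k.+1 t| <= A t * 2^-1 ^+ k.
  move=> t; have [t0|_] := leP 0 t; last by exists 0.
  have [l Hl] := geometric_cvg (A0 t) (fun k => zsA k t t0).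
  by exists l.
pose z t := zl (Num.max 0 t).
have z_ge0 t : 0 <= t -> z t = zl t by move=> t0; rewrite /z (max_idPr t0).
have lipz : lip z.
  have H s t : 0 <= s -> 0 <= t -> `|zl t - zl s| <= K * `|t - s|.
    move=> s0 t0; have [cs _] := Hzl s s0; have [ct _] := Hzl t t0.
    have : `|zs k.+1 t - zs k.+1 s| @[k --> \oo] --> `|zl t - zl s|.
      by apply: cvg_norm; exact: cvgB.
    by move=> /cvgr_to_le; apply; apply: nearW => k; exact: lipzs.
  move=> s t; apply: (le_trans (H _ _ _ _)); rewrite ?le_max ?lexx//.
  by rewrite ler_wpM2l// maxr_lipschitz.
have [lipz' solz'] := Hstep _ lipz.
(* The witness is [step z], whose derivative is known, rather than the limit [z]. *)
exists (step z); case: (solz') => z'0 dz'; split => //.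
have zz' t : 0 <= t -> step z t = z t.
  move=> t0; apply/eqP; rewrite -subr_eq0 -normr_le0.
  apply: (@geometric_eq0 _ _ (A t)) => k.
  have p0 : 0 <= 2 * 2^-1 ^+ k :> R by rewrite mulr_ge0// exprn_ge0// invr_ge0.
  have := contr _ z (zs k.+1) _ _ p0 lipz' (lipzs _) solz' (solzs k.+1) _ t t0.
  have Hz s : 0 <= s ->
      `|F (z s) - F (zs k.+1 s)| <= L * (2 * 2^-1 ^+ k * expR (2 * L * s)).
    move=> s0; apply: (le_trans (FL _ _)); rewrite ler_pM2l// z_ge0//.
    by rewrite mulrAC; exact: (Hzl s s0).2.
  move=> /(_ Hz) h1; have := (Hzl t t0).2 k.+1; rewrite -z_ge0// => h2.
  rewrite -(subrKA (zs k.+2 t)); apply: (le_trans (ler_normD _ _)).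
  rewrite [X in _ + X]distrC; move: h1 h2; rewrite /A exprS; lra.
apply: filterS dz' => t H t0; rewrite zz'; [exact: H|exact: ltW].
Qed.

End Picard.

(** * Comparison functions *)

Section Comparison.
Context {R : realType}.

(** A K-function is continuous only relative to the half-line; clamping the argument gives a
    function continuous on all of [R]. *)
Lemma K_clamp_continuous (alpha : R -> R) : K_function alpha ->
  continuous (fun s : R => alpha (Num.max 0 s)).
Proof.
move=> [ca _ _] t; apply/cvgrPdist_lt => e e0.
have A0 (s : R) : [set r : R | 0 <= r /\ (r%:E < +oo)%E] (Num.max 0 s).
  by split; [rewrite le_max lexx|exact: ltry].
have /cvgrPdist_lt/(_ _ e0) := (subspace_continuousP _ _).1 ca _ (A0 t).
rewrite near_withinE => /nbhs_ballP[d /= d0 Hd].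
apply/nbhs_ballP; exists d => //= s; rewrite /ball/= => ts.
by apply: Hd (A0 s); exact: le_lt_trans (maxr_lipschitz 0 s t) ts.
Qed.

Lemma K_ge0 (alpha : R -> R) (s : R) : K_function alpha -> 0 <= s -> 0 <= alpha s.
Proof.
move=> [_ inc a0]; rewrite le_eqVlt => /predU1P[<-|s0]; first by rewrite a0.
by rewrite -a0 ltW// inc// ltry.
Qed.

Lemma K_le (alpha : R -> R) (s t : R) : K_function alpha -> 0 <= s -> s <= t ->
  alpha s <= alpha t.
Proof.
move=> [_ inc a0] s0; rewrite le_eqVlt => /predU1P[->//|st].
by rewrite ltW// inc// ltry.
Qed.

(* [beta r t] is the solution [s] of [s + t * rho s = r]: a function decaying
   at rate at least [rho s] as long as it exceeds [s] drops from [r] to [s]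
   within time [t]. *)
Lemma KL_inverse (rho : R -> R) : continuous rho -> rho 0 = 0 ->
  (forall s, 0 < s -> 0 < rho s) ->
  (forall s t, 0 <= s -> s <= t -> rho s <= rho t) ->
  exists2 beta : R -> R -> R, KL_function beta &
    forall r t, 0 <= r -> 0 <= t ->
      0 <= beta r t /\ beta r t + t * rho (beta r t) = r.
Proof.
move=> cr r0 r_gt0 r_le.
have r_ge0 s : 0 <= s -> 0 <= rho s.
  by rewrite le_eqVlt => /predU1P[<-|/r_gt0/ltW//]; rewrite r0.
have /choice[b Hb] : forall rt : R * R, exists s, 0 <= rt.1 -> 0 <= rt.2 ->
    0 <= s /\ s + rt.2 * rho s = rt.1.
  move=> [r t] /=; have [r'0|_] := leP 0 r; last by exists 0.
  have [t0|_] := leP 0 t; last by exists 0.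
  have cf : continuous (fun s => s + t * rho s).
    move=> s; apply: cvgD; first exact: cvg_id.
    by apply: cvgMl_tmp; exact: cr.
  have rt : r <= r + t * rho r by rewrite lerDl mulr_ge0// r_ge0.
  have [||s] := @IVT _ (fun s => s + t * rho s) 0 r r r'0.
  - exact: continuous_subspaceT.
  - by rewrite r0 mulr0 addr0 ge_min r'0/= le_max rt orbT.
  - by rewrite in_itv/= => /andP[s0 _] sr; exists s.
have uniq t s s' : 0 <= t -> 0 <= s -> s < s' -> s + t * rho s < s' + t * rho s'.
  by move=> t0 s0 ss'; rewrite ltr_leD// ler_wpM2l// r_le// ltW.
pose beta r t := b (Num.max 0 r, t).
have Hbeta r t : 0 <= r -> 0 <= t -> 0 <= beta r t /\ beta r t + t * rho (beta r t) = r.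
  by move=> r'0 t0; rewrite /beta (max_idPr r'0); exact: Hb.
have lt_beta r s t : 0 <= t -> 0 <= r -> r < s -> beta r t < beta s t.
  move=> t0 r'0 rs; have s0 := le_trans r'0 (ltW rs).
  have [br Er] := Hbeta _ _ r'0 t0; have [bs Es] := Hbeta _ _ s0 t0.
  rewrite ltNge; apply/negP; rewrite le_eqVlt => /predU1P[E|/(uniq _ _ _ t0 bs)].
    by move: rs; rewrite -Er -Es E ltxx.
  by rewrite Es Er ltNge ltW.
exists beta => //; split => [t t0|r s t r'0 s0 st|r r'0].
- split=> [|r s r'0 rs _|].
  + apply: continuous_subspaceT.
    (* For fixed [t] the function is 1-Lipschitz, being inverse to a map that expands distances. *)
    have H r s : 0 <= r -> r <= s -> `|beta s t - beta r t| <= `|s - r|.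
      move=> r'0 rs; have s0 := le_trans r'0 rs.
      have [br Er] := Hbeta _ _ r'0 t0; have [bs Es] := Hbeta _ _ s0 t0.
      have brs : beta r t <= beta s t.
        by move: rs; rewrite le_eqVlt => /predU1P[->//|/(lt_beta _ _ _ t0 r'0)/ltW].
      rewrite !ger0_norm ?subr_ge0// -[in leRHS]Er -[in leRHS]Es.
      have : t * rho (beta r t) <= t * rho (beta s t) by rewrite ler_wpM2l// r_le.
      lra.
    have maxK (r : R) : beta (Num.max 0 r) t = beta r t.
      by rewrite /beta; congr (b (_, _)); apply: max_r; rewrite le_max lexx.
    have max0 (r : R) : 0 <= Num.max 0 r by rewrite le_max lexx.
    have lip r s : `|beta s t - beta r t| <= `|s - r|.
      apply: le_trans (maxr_lipschitz 0 r s); rewrite -(maxK s) -(maxK r).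
      have [rs|/ltW sr] := leP (Num.max 0 r) (Num.max 0 s); first exact: H.
      by rewrite distrC [leRHS]distrC; exact: H.
    move=> r; apply/cvgrPdist_lt => e e0; apply/nbhs_ballP; exists e => //= s.
    by rewrite /ball/= => rs; exact: le_lt_trans (lip _ _) rs.
  + exact: lt_beta.
  + by have [] := Hbeta 0 t (lexx _) t0 => b0; have := mulr_ge0 t0 (r_ge0 _ b0); lra.
- have t0 := le_trans s0 st.
  have [bs Es] := Hbeta _ _ r'0 s0; have [bt Et] := Hbeta _ _ r'0 t0.
  rewrite leNgt; apply/negP => /(uniq _ _ _ s0 bs); rewrite Es => H.
  have : s * rho (beta r t) <= t * rho (beta r t) by rewrite ler_wpM2r// r_ge0.
  lra.
(* If [beta r t] exceeded [e], then [t * rho e] would be at most [r], which fails for large [t]. *)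
- apply/cvgrPdist_le => e e0; near=> t.
  have t0 : 0 <= t by near: t; exact: nbhs_pinfty_ge.
  have [bt Et] := Hbeta _ _ r'0 t0.
  rewrite sub0r normrN ger0_norm// leNgt; apply/negP => ebt.
  have : t * rho e <= t * rho (beta r t) by rewrite ler_wpM2l// r_le// ltW.
  have : r < t * rho e.
    rewrite -ltr_pdivrMr ?r_gt0//.
    by near: t; apply: nbhs_pinfty_gt; rewrite num_real.
  lra.
Unshelve. all: by end_near. Qed.

(** The inverse of [m * alpha] on [[0, 1]]: it exists by the intermediate value theorem, and
    inverses of continuous injections of a segment are continuous. *)
Lemma K_inverse (alpha : R -> R) (m : R) : K_function alpha -> 0 < m ->
  exists2 gamma : R -> R, K_function_on (m * alpha 1)%:E gamma &
    forall r, 0 <= r < m * alpha 1 -> 0 <= gamma r <= 1 /\ m * alpha (gamma r) = r.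
Proof.
move=> Ka m0; have [_ inc a0] := Ka.
pose f s := m * alpha (Num.max 0 s).
have fE s : 0 <= s -> f s = m * alpha s by move=> s0; rewrite /f (max_idPr s0).
have cf : {within `[0, 1], continuous f}.
  apply: continuous_subspaceT => s; apply: cvgMl_tmp.
  exact: (K_clamp_continuous Ka).
have f0 : f 0 = 0 by rewrite fE// a0 mulr0.
have f1 : f 1 = m * alpha 1 by rewrite fE.
have f_inc s t : 0 <= s -> s < t -> f s < f t.
  move=> s0 st; rewrite !fE ?(le_trans s0 (ltW st))//.
  by rewrite ltr_pM2l// inc// ltry.
have f01 : f 0 <= f 1 by rewrite ltW// f_inc.
have /choice[g Hg] : forall r, exists s, f 0 <= r <= f 1 -> 0 <= s <= 1 /\ f s = r.
  move=> r; have [rr|_] := boolP (f 0 <= r <= f 1); last by exists 0.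
  have [|s] := IVT ler01 cf (v := r); first by rewrite (min_idPl f01) (max_idPr f01).
  by rewrite in_itv/= => s01 fs; exists s.
have fK : {in `[0, 1], cancel f g}.
  move=> s; rewrite in_itv/= => /andP[s0 s1].
  have [|/andP[g0 g1] E] := Hg (f s).
    have f_le u v : 0 <= u -> u <= v -> f u <= f v.
      by move=> u0; rewrite le_eqVlt => /predU1P[->//|/(f_inc _ _ u0)/ltW].
    by rewrite !f_le.
  have [gs|sg|//] := ltgtP (g (f s)) s.
    by have := f_inc _ _ g0 gs; rewrite E ltxx.
  by have := f_inc _ _ s0 sg; rewrite E ltxx.
have cg := segment_can_le_continuous ler01 cf fK.
have Hg' r : 0 <= r < m * alpha 1 -> 0 <= g r <= 1 /\ m * alpha (g r) = r.
  move=> /andP[r0 r1]; have [|g01 E] := Hg r; first by rewrite f0 f1 r0 ltW.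
  by split => //; rewrite -fE//; case/andP : g01.
exists g => //; split => [|r s r0 rs|].
- apply: continuous_subspaceW cg => r /= [r0]; rewrite lte_fin => r1.
  by rewrite in_itv/= f0 f1 r0 ltW.
- rewrite lte_fin => s1; have s0 := le_trans r0 (ltW rs).
  have [|/andP[gr0 _] Er] := Hg' r; first by rewrite r0 (lt_trans rs).
  have [|/andP[gs0 _] Es] := Hg' s; first by rewrite s0.
  rewrite ltNge; apply/negP => /(K_le Ka gs0); rewrite leNgt => /negP; apply.
  by rewrite -(ltr_pM2l m0) Er Es.
- by rewrite -[in LHS]f0 fK// in_itv/= lexx ler01.
Qed.

End Comparison.

(** * Perturbed gradient flows *)

Section Energy.
Context {R : realType} {n : nat}.
Local Notation mu := (@lebesgue_measure R).
Variables (Z : set 'rV[R]_n) (zstar : 'rV[R]_n) (J : 'rV[R]_n -> R) (eta : R).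
Hypotheses (oZ : open Z) (eta0 : 0 < eta).
Hypothesis sJ : size_function Z zstar (fun z => J z - J zstar).
Hypothesis cJ : Ck_on 1 Z J.
Variable alpha : R -> R.
Hypothesis Kalpha : K_function alpha.
Hypothesis alphaJ : forall z, Z z -> alpha (J z - J zstar) <= enorm (grad J z).

(** Completing the square in each coordinate leaves half of the gradient term plus the square of
    [enorm e] over [2 * eta]. By the condition on [D] the latter is at most
    [eta / 8 * alpha s ^+ 2]; of the remaining factor 3/8 only 1/4 is kept. *)
Lemma dissipation (z e : 'rV[R]_n) (s D : R) : Z z -> enorm e <= D ->
  0 <= s -> 2 * D <= eta * alpha s -> s <= J z - J zstar ->
  \sum_i partial i J z * perturbed_gradient_flow eta J z e ord0 i
    <= - (eta / 4 * alpha s ^+ 2).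
Proof.
move=> Zz eD s0 sD sw; set p := grad J z.
have D0 : 0 <= D := le_trans (enorm_ge0 _) eD.
have as0 := K_ge0 Kalpha s0.
have ap : alpha s <= enorm p by apply: le_trans (alphaJ Zz); exact: K_le.
apply: (@le_trans _ _ (- (eta / 2 * enorm p ^+ 2) + enorm e ^+ 2 / (2 * eta))).
  rewrite !sqr_enorm mulr_sumr mulr_suml -sumrN -big_split/=.
  apply: ler_sum => i _; rewrite !mxE -subr_ge0.
  set x := partial i J z; set y := e ord0 i.
  have -> : - (eta / 2 * x ^+ 2) + y ^+ 2 / (2 * eta) - x * (- (eta * x) + y) =
      (eta * x - y) ^+ 2 / (2 * eta) by field; rewrite gt_eqF.
  by rewrite divr_ge0 ?sqr_ge0// mulr_ge0// ltW.
have H1 : alpha s ^+ 2 <= enorm p ^+ 2.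
  by rewrite ler_pXn2r ?nnegrE// enorm_ge0.
have H2 : enorm e ^+ 2 <= D ^+ 2 by rewrite ler_pXn2r ?nnegrE// enorm_ge0.
have H3 : (2 * D) ^+ 2 <= (eta * alpha s) ^+ 2.
  by rewrite ler_pXn2r ?nnegrE// mulr_ge0// ltW.
have H4 : enorm e ^+ 2 / (2 * eta) <= eta / 8 * alpha s ^+ 2.
  rewrite ler_pdivrMr ?mulr_gt0//; apply: (le_trans H2).
  by move: H3; rewrite !exprMn; lra.
have H5 : eta * alpha s ^+ 2 <= eta * enorm p ^+ 2 by rewrite ler_pM2l.
have H6 : 0 <= eta * alpha s ^+ 2 by rewrite mulr_ge0 ?sqr_ge0// ltW.
lra.
Qed.

(** The maximum of [s] and the energy is nonincreasing. So if the final energy exceeds [s], all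
    earlier values do, the dissipation rate holds almost everywhere on the interval, and it can be
    integrated. *)
Lemma energy_decay (z e : R -> 'rV[R]_n) (b K c D s : R) : 0 <= b ->
  (forall s t, `|z t - z s| <= K * `|t - s|) ->
  (forall t, 0 <= t <= b -> Z (z t) /\ J (z t) - J zstar <= c) ->
  (\forall t \ae mu, 0 <= t -> enorm (e t) <= D) ->
  (\forall t \ae mu, 0 < t -> t < b ->
    is_derive t (1 : R) z (perturbed_gradient_flow eta J (z t) (e t))) ->
  0 <= s -> 2 * D <= eta * alpha s ->
  J (z b) - J zstar <= s \/
  J (z b) - J zstar + b * (eta / 4 * alpha s ^+ 2) <= J (z 0) - J zstar.
Proof.
move=> b0 zK zc eD dz s0 sD; pose w t := J (z t) - J zstar.
have [ws|sw] := leP (w b) s; [by left|right].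
have acw : scalar_ac 0 b w.
  (* On the sublevel set [J] coincides with a globally Lipschitz function, so the energy is
     Lipschitz in time. *)
  have [g [L [L0 gL _ gJ]]] := lipschitz_extension oZ sJ cJ c cJ.
  apply: (scalar_ac_lipschitz (L := L * K)) => r t rb tb.
  have [Zr rc] := zc _ rb; have [Zt tc] := zc _ tb.
  rewrite (_ : w t - w r = g (z t) - g (z r)); last by rewrite !gJ// /w; ring.
  by apply: (le_trans (gL _ _)); rewrite -mulrA ler_wpM2l// ltW.
have dw : \forall t \ae mu, 0 < t -> t < b -> s <= w t ->
    exists2 l, is_derive t (1 : R) w l & l <= - (eta / 4 * alpha s ^+ 2).
  apply: filterS2 eD dz => t et dz t0 tb st.
  have [Zt _] : Z (z t) /\ J (z t) - J zstar <= c by apply: zc; rewrite !ltW.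
  exists (\sum_i partial i J (z t) * perturbed_gradient_flow eta J (z t) (e t) ord0 i).
    have := is_deriveB (is_derive_comp_rV (cJ.1 _ Zt) (dz t0 tb))
      (is_derive_cst (J zstar) t (1 : R)).
    by rewrite subr0.
  by apply: (dissipation _ (et (ltW t0))).
have rho0 : 0 <= eta / 4 * alpha s ^+ 2.
  by rewrite mulr_ge0 ?sqr_ge0// divr_ge0// ltW.
pose v t := Num.max s (w t).
have acv : scalar_ac 0 b v.
  by apply: (scalar_ac_comp (L := 1) acw) => r t _ _; rewrite mul1r maxr_lipschitz.
(* Where [w t < s] the maximum is constant just after [t]; elsewhere [w] has a nonpositive
   derivative and [v t = w t]. *)
have dini : \forall t \ae mu, 0 < t -> t < b -> forall eps : R, 0 < eps ->
    exists2 d : R, 0 < d & forall r, t < r -> r < t + d -> v r - v t <= eps * (r - t).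
  apply: filterS dw => t H t0 tb eps e0; have [ws|sw'] := ltP (w t) s.
    have ws0 : 0 < s - w t by rewrite subr_gt0.
    have [d d0 wd] := scalar_ac_unif acw ws0.
    exists (Num.min d (b - t)); first by rewrite lt_min d0 subr_gt0.
    move=> r tr rd; have : r - t < Num.min d (b - t) by rewrite ltrBlDl.
    rewrite lt_min ltrD2r => /andP[rtd rb].
    have := wd _ _ (ltW t0) (ltW tr) (ltW rb) rtd; rewrite ltr_norml => /andP[_ wr].
    have wrs : w r <= s by lra.
    by rewrite /v (max_idPl wrs) (max_idPl (ltW ws)) subrr mulr_ge0 ?subr_ge0// ltW.
  have [l dl l0] := H t0 tb sw'.
  have l0' : l <= 0 by apply: (le_trans l0); rewrite oppr_le0.
  have [d d0 wd] := is_derive_dini dl l0' e0.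
  exists d => // r tr rd; have := wd _ tr rd; rewrite /v (max_idPr sw').
  have : 0 <= eps * (r - t) by rewrite mulr_ge0 ?subr_ge0// ltW.
  by move=> h1 h2; rewrite lerBlDr ge_max; apply/andP; split; lra.
have vb r : 0 <= r <= b -> s < w r.
  move=> /andP[r0 rb]; have : v b <= v r.
    apply: scalar_ac_nincr => //; first exact: scalar_ac_sub acv r0 _.
    by apply: filterS dini => t H rt tb; apply: H => //; exact: le_lt_trans rt.
  rewrite /v ge_max => /andP[_]; rewrite le_max.
  by move=> /orP[/(lt_le_trans sw)|/(lt_le_trans sw)//]; rewrite ltxx.
pose k := - (eta / 4 * alpha s ^+ 2).
have : w b - w 0 <= (k \*: (id : R -> R)) b - (k \*: (id : R -> R)) 0.
  apply: scalar_ac_le => //.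
    apply: (scalar_ac_lipschitz (L := `|k|)) => r t _ _.
    by rewrite /= -scalerBr normrM.
  apply: filterS dw => t H t0 tb.
  have [|l dl lk] := H t0 tb; first by apply/ltW/vb; rewrite !ltW.
  exists l, (k *: (1 : R)); split => //; first exact: is_deriveZ.
  by rewrite [leRHS]mulr1.
rewrite /= -[k *: b]/(k * b) scaler0 /k /w; lra.
Qed.

End Energy.

Section Inputs.
Context {R : realType} {n : nat}.
Local Notation mu := (@lebesgue_measure R).

Lemma ess_normP (e : R -> 'rV[R]_n) (d : R) : (ess_norm e < d%:E)%E ->
  [/\ 0 <= fine (ess_norm e), fine (ess_norm e) < d &
    \forall t \ae mu, 0 <= t -> enorm (e t) <= fine (ess_norm e)].
Proof.
move=> ed.
have e0 : (0 <= ess_norm e)%E.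
  apply: ess_sup_gee.
    have -> : [set: R] = [set` `]-oo, +oo[] by rewrite set_itvNyy.
    by rewrite [X in (_ < X)%E]lebesgue_measure_itv/= addey // ltry.
  by apply: nearW => t; case: ifP => // _; rewrite lee_fin enorm_ge0.
have fe : ess_norm e \is a fin_num by rewrite ge0_fin_numE// (lt_trans ed) ?ltry.
split; first exact: fine_ge0.
  by rewrite -lte_fin fineK.
have := ess_sup_ge mu (fun s : R => if 0 <= s then (enorm (e s))%:E else 0%E).
by apply: filterS => t + t0; rewrite t0 -/(ess_norm e) -(fineK fe) lee_fin.
Qed.

(** Picard iteration asks for a Borel input bounded at every time; clamping each coordinate to
    [[- D, D]] achieves this at the cost of a null set of nonnegative times. *)
Lemma borel_input (e : R -> 'rV[R]_n) (D : R) : measurable_input e -> 0 <= D ->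
  (\forall t \ae mu, 0 <= t -> enorm (e t) <= D) ->
  exists f : R -> 'rV[R]_n, [/\
    forall i, measurable_fun setT (fun t => f t ord0 i),
    forall t, `|f t| <= D &
    \forall t \ae mu, 0 <= t -> e t = f t].
Proof.
move=> me D0 eD.
have /choice[g Hg] : forall i, exists g : R -> R, measurable_fun setT g /\
    \forall t \ae mu, 0 <= t -> e t ord0 i = g t.
  by move=> i; have [g ? ?] := lebesgue_borel (me i); exists g.
exists (fun t => \row_i Num.max (- D) (Num.min D (g i t))); split.
- move=> i; rewrite (_ : (fun t => _) = cst (- D) \max (cst D \min g i)); last first.
    by apply/funext => t; rewrite mxE.
  apply: measurable_maxr => //; apply: measurable_minr => //.
  by have [] := Hg i.
- move=> t; apply: norm_le_coord => // i; rewrite mxE ler_norml.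
  by rewrite le_max lexx ge_max ge_min lexx/= andbT; lra.
- have : \forall t \ae mu, forall i, 0 <= t -> e t ord0 i = g i t.
    by apply: ae_ord => i; have [] := Hg i.
  move=> H; apply: filterS2 eD H => t et eg t0; apply/rowP => i.
  rewrite mxE -eg//; have := le_trans (coord_le_enorm (e t) i) (et t0).
  by rewrite ler_norml => /andP[h1 h2]; rewrite (min_idPr h2) (max_idPr h1).
Qed.

End Inputs.

Section Flow.
Context {R : realType} {n : nat}.
Local Notation mu := (@lebesgue_measure R).
Variables (Z : set 'rV[R]_n) (zstar : 'rV[R]_n) (J : 'rV[R]_n -> R) (eta : R).
Hypotheses (oZ : open Z) (eta0 : 0 < eta).
Hypothesis sJ : size_function Z zstar (fun z => J z - J zstar).
Hypothesis smJ : smooth_on Z J.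

Let cJ : Ck_on 1 Z J. Proof. exact: smJ. Qed.

(** Second derivatives of [J] enter here: the extension is applied to the coordinates of the
    gradient, which must be continuously differentiable. *)
Lemma flow_lipschitz (c : R) :
  exists (F : 'rV[R]_n -> 'rV[R]_n) (L : R), [/\ 0 < L,
    forall x y, `|F x - F y| <= L * `|x - y|,
    forall x, `|F x| <= L &
    forall x e, Z x -> J x - J zstar <= c ->
      F x + e = perturbed_gradient_flow eta J x e].
Proof.
have cg i : Ck_on 1 Z (fun x => grad J x ord0 i).
  rewrite (_ : (fun x => _) = partial i J); last by apply/funext => x; rewrite mxE.
  by have [_] := smJ 2; apply.
have [F [L [L0 FL FM FE]]] := lipschitz_extension_rV oZ sJ cJ c cg.
exists (fun x => - (eta *: F x)), (eta * L); split.
- exact: mulr_gt0.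
- move=> x y; rewrite -opprD normrN -scalerBr normrZ gtr0_norm// -mulrA.
  by rewrite ler_pM2l.
- by move=> x; rewrite normrN normrZ gtr0_norm// ler_pM2l.
- by move=> x e Zx xc; rewrite /perturbed_gradient_flow FE.
Qed.

Lemma abs_continuous_clamp (z : R -> 'rV[R]_n) (b : R) : 0 <= b ->
  abs_continuous_on 0 b z -> continuous (fun t => z (Num.max 0 (Num.min b t))).
Proof.
move=> b0 acz t; apply/cvgrPdist_lt => e e0; have [d d0 zd] := acz _ e0.
pose cl s := Num.max 0 (Num.min b s).
have cl0 s : 0 <= cl s by rewrite le_max lexx.
have clb s : cl s <= b by rewrite ge_max b0 ge_min lexx.
have clL r s : `|cl s - cl r| <= `|s - r|.
  apply: (le_trans (maxr_lipschitz _ _ _)).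
  have := maxr_lipschitz (- b) (- r) (- s).
  by rewrite -!oppr_min -!opprD !normrN.
have H r s : cl r <= cl s -> `|s - r| < d -> enorm (z (cl s) - z (cl r)) < e.
  move=> rs rd; have := zd 1%N (fun=> cl r) (fun=> cl s); rewrite !big_ord1; apply.
  - by move=> _.
  - by move=> i j _ _ _; rewrite !ord1.
  - by apply: le_lt_trans rd; apply: le_trans (clL r s); exact: ler_norm.
apply/nbhs_ballP; exists d => //= s; rewrite /ball/= => ts.
have [rs|/ltW sr] := leP (cl s) (cl t).
  by apply: le_lt_trans (norm_le_enorm _) _; exact: H.
rewrite distrC; apply: le_lt_trans (norm_le_enorm _) _.
by apply: H => //; rewrite distrC.
Qed.

(** A competing solution comes with no energy bound; continuity on a compact time interval supplies
    one. *)
Lemma abs_continuous_sublevel (z : R -> 'rV[R]_n) (b : R) : 0 <= b ->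
  abs_continuous_on 0 b z -> (forall t, 0 <= t <= b -> Z (z t)) ->
  exists c, forall t, 0 <= t <= b -> J (z t) - J zstar <= c.
Proof.
move=> b0 acz Zz; have cz := abs_continuous_clamp b0 acz.
pose cl s : R := Num.max 0 (Num.min b s).
have clE s : 0 <= s <= b -> cl s = s.
  by move=> /andP[s0 sb]; rewrite /cl (min_idPr sb) (max_idPr s0).
have Zcl s : Z (z (cl s)).
  by apply: Zz; rewrite le_max lexx/= ge_max b0 ge_min lexx.
have cJz : continuous (fun t => J (z (cl t))).
  move=> t; apply: (@continuous_comp _ _ _ (fun t => z (cl t)) J); first exact: cz.
  exact: (differentiable_continuous (cJ.1 _ (Zcl t))).
have [m _ Hm] := EVT_max b0 (continuous_subspaceT cJz).
exists (J (z (cl m)) - J zstar) => t tb.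
by rewrite lerD2r -{1}(clE t tb); apply: Hm; rewrite in_itv.
Qed.

(** Up to time [b] both curves lie in a common sublevel set, where they solve the same globally
    Lipschitz equation. *)
Lemma flow_unique (e : R -> 'rV[R]_n) (b : R) (z1 z2 : R -> 'rV[R]_n) : 0 <= b ->
  z1 0 = z2 0 -> abs_continuous_on 0 b z1 -> abs_continuous_on 0 b z2 ->
  (forall t, 0 <= t <= b -> Z (z1 t)) -> (forall t, 0 <= t <= b -> Z (z2 t)) ->
  (\forall t \ae mu, 0 < t -> t < b ->
    is_derive t (1 : R) z1 (perturbed_gradient_flow eta J (z1 t) (e t))) ->
  (\forall t \ae mu, 0 < t -> t < b ->
    is_derive t (1 : R) z2 (perturbed_gradient_flow eta J (z2 t) (e t))) ->
  z1 b = z2 b.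
Proof.
move=> b0 z0 ac1 ac2 Z1 Z2 d1 d2.
have [c1 H1] := abs_continuous_sublevel b0 ac1 Z1.
have [c2 H2] := abs_continuous_sublevel b0 ac2 Z2.
have [F [L [L0 FL FM FE]]] := flow_lipschitz (Num.max c1 c2).
apply: (lipschitz_unique (F := F) (e := e) (b := b) L0 FL FM) => //.
- by move=> i; exact: abs_continuous_coord.
- by move=> i; exact: abs_continuous_coord.
- apply: filterS d1 => t H t0 tb; have tb' : 0 <= t <= b by rewrite !ltW.
  by rewrite FE; [exact: H|exact: Z1|rewrite le_max H1].
- apply: filterS d2 => t H t0 tb; have tb' : 0 <= t <= b by rewrite !ltW.
  by rewrite FE; [exact: H|exact: Z2|rewrite le_max H2// orbT].
- by rewrite b0 lexx.
Qed.

Variable alpha : R -> R.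
Hypothesis Kalpha : K_function alpha.
Hypothesis alphaJ : forall z, Z z -> alpha (J z - J zstar) <= enorm (grad J z).

(* The right-hand side is replaced by a globally Lipschitz field that agrees
   with it on a sublevel set of [J], which the solution never leaves. *)
Lemma flow_exists (e : R -> 'rV[R]_n) (z0 : 'rV[R]_n) (D s : R) :
  measurable_input e -> 0 <= D ->
  (\forall t \ae mu, 0 <= t -> enorm (e t) <= D) -> Z z0 ->
  0 <= s -> 2 * D <= eta * alpha s ->
  exists z : R -> 'rV[R]_n, [/\ z 0 = z0,
    exists K, forall r t, `|z t - z r| <= K * `|t - r|,
    exists c, forall t, 0 <= t -> Z (z t) /\ J (z t) - J zstar <= c &
    \forall t \ae mu, (0 : R) < t ->
      is_derive (t : R) (1 : R) z (perturbed_gradient_flow eta J (z t) (e t))].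
Proof.
move=> me D0 eD Zz0 s0 sD.
pose c := Num.max s (J z0 - J zstar).
(* The margin above [c] lets the solution be followed slightly past any time up to which its energy
   is known to be at most [c]. *)
have [F [L [L0 FL FM FE]]] := flow_lipschitz (c + 1).
have [f [mf fD ef]] := borel_input me D0 eD.
have [z [z_0 zK dz]] := picard z0 L0 FL FM mf fD.
have dz' : \forall t \ae mu, (0 : R) < t -> is_derive (t : R) (1 : R) z (F (z t) + e t).
  by apply: filterS2 ef dz => t eft dzt t0; rewrite eft ?ltW//; exact: dzt.
have cz : continuous z := continuous_of_lipschitz zK.
pose K := [set x | Z x /\ J x - J zstar <= c].
have cK : closed K.
  apply: compact_closed; first exact: norm_hausdorff.
  exact: sublevel_compact oZ sJ c.
have inK t : 0 <= t -> K (z t).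
  move: t; apply: real_induction => t t0 IH.
  have Kt : K (z t).
    move: t0; rewrite le_eqVlt => /predU1P[<-|t0].
      by rewrite z_0; split => //; rewrite le_max lexx orbT.
    apply: contrapT => nK.
    have : nbhs (z t) (~` K) by apply: open_nbhs_nbhs; split => //; exact: closed_openC.
    move=> /cz /nbhs_ballP[d /= d0 Hd].
    pose r := Num.max 0 (t - d / 2).
    have rt : r < t by rewrite gt_max t0/=; lra.
    apply: (Hd r); last by apply: IH => //; rewrite le_max lexx.
    rewrite /ball/= gtr0_norm ?subr_gt0// ltrBlDr -ltrBlDl lt_max.
    by apply/orP; right; lra.
  have [Zt wt] := Kt.
  have nZ : \forall x \near z t, Z x by exact: open_nbhs_nbhs.
  have nJ : \forall x \near z t, J x - J zstar < c + 1.
    have cJt : J x @[x --> z t] --> J (z t).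
      exact: (differentiable_continuous (cJ.1 _ Zt)).
    have : J (z t) < c + 1 + J zstar by lra.
    by move=> /(cvgr_lt _ cJt); apply: filterS => x; rewrite ltrBlDr.
  have : \forall x \near z t, Z x /\ J x - J zstar < c + 1 by exact: filterI nZ nJ.
  move=> /cz /nbhs_ballP[d /= d0 Hd]; exists d => // r tr rd.
  have r0 : 0 <= r := le_trans t0 tr.
  have Hr u : 0 <= u <= r -> Z (z u) /\ J (z u) - J zstar <= c + 1.
    move=> /andP[u0 ur]; have [ut|tu] := ltP u t.
      by have [? uc] := IH _ u0 ut; split => //; apply: (le_trans uc); rewrite lerDl.
    have [|? /ltW//] := Hd u; rewrite /ball/= distrC ger0_norm ?subr_ge0//.
    by rewrite ltrBlDl (le_lt_trans ur).
  split; first by have [|] := Hr r; rewrite ?r0 ?lexx.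
  (* Both alternatives end at or below [c]: the energy at [r] is at most [s] or at most its initial
     value. *)
  have [|H|H] := @energy_decay _ _ Z zstar J eta oZ eta0 sJ cJ alpha Kalpha alphaJ
      z e r (L + D) (c + 1) D s r0 zK Hr eD _ s0 sD.
  - apply: filterS dz' => u H u0 ur; have [|Zu uc] := Hr u; first by rewrite !ltW.
    by rewrite -FE//; exact: H.
  - by rewrite le_max H.
  - rewrite le_max; apply/orP; right; rewrite -z_0; apply: le_trans H; rewrite lerDl.
    by rewrite mulr_ge0// mulr_ge0 ?sqr_ge0// divr_ge0// ltW.
exists z; split => //; first by exists (L + D).
  by exists c.
apply: filterS dz' => t H t0; have [Zt ct] := inK t (ltW t0).
rewrite -FE//; first exact: H.
by apply: (le_trans ct); rewrite lerDl.
Qed.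

End Flow.

Theorem theorem4p1 (R : realType) (n : nat) (Z : set 'rV[R]_n)
    (J : 'rV[R]_n -> R) (zstar : 'rV[R]_n) (eta : R) :
  open Z -> Z zstar -> (forall z, Z z -> J zstar <= J z) -> 0 < eta ->
  proper_objective Z zstar J ->
  small_disturbance_ISS Z zstar (perturbed_gradient_flow eta J).
Proof.
move=> oZ _ Jmin eta0 [smJ sJ [alpha Ka aJ]].
have cJ : Ck_on 1 Z J by exact: smJ.
have a_gt0 s : 0 < s -> 0 < alpha s.
  by move=> s0; case: (Ka) => _ inc <-; apply: inc => //; exact: ltry.
pose rho s := eta / 4 * alpha (Num.max 0 s) ^+ 2.
have rhoE s : 0 <= s -> rho s = eta / 4 * alpha s ^+ 2.
  by move=> s0; rewrite /rho (max_idPr s0).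
have eta4 : 0 < eta / 4 by rewrite divr_gt0.
have eta2 : 0 < eta / 2 by rewrite divr_gt0.
have [|||s t s0 st|beta KLb Hb] := @KL_inverse R rho.
- move=> s; apply: cvgMl_tmp; apply: (@continuous_comp _ _ _ _ (fun x : R => x ^+ 2)).
    exact: (K_clamp_continuous Ka).
  exact: exprn_continuous.
- by rewrite rhoE//; case: Ka => _ _ ->; rewrite expr0n mulr0.
- by move=> s s0; rewrite rhoE ?ltW// mulr_gt0// exprn_gt0// a_gt0.
- rewrite !rhoE ?(le_trans s0)// ler_pM2l//.
  rewrite ler_pXn2r ?nnegrE ?(K_ge0 Ka) ?(le_trans s0)//.
  exact: (K_le Ka).
have [gamma Kg Hg] := K_inverse Ka eta2.
exists (fun z => J z - J zstar), (eta / 2 * alpha 1)%:E, beta, gamma; split => //.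
  by rewrite lte_fin mulr_gt0// a_gt0.
move=> e z0 [me _] /ess_normP[]; set D := fine _ => D0 Dd eD Zz0.
have [|/andP[g0 g1] gD] := Hg D; first by rewrite D0.
have sD s : gamma D <= s -> 2 * D <= eta * alpha s.
  move=> gs; have := K_le Ka g0 gs; rewrite -(ler_pM2l eta0); move: gD; lra.
have [z [z_0 [K zK] [c zc] dz]] :=
  flow_exists oZ eta0 sJ smJ Ka aJ me D0 eD Zz0 g0 (sD _ (lexx _)).
have acz b : abs_continuous_on 0 b z.
  by apply: (abs_continuous_lipschitz (L := K)) => r t _ _; exact: zK.
exists z; [split|].
- split => //; first by move=> t t0 _; have [] := zc t t0.
  by apply: filterS dz => t H t0 _; exact: H.
- move=> T z' [z'_0 Zz' acz' dz'] t t0 tT.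
  apply: (flow_unique oZ eta0 sJ smJ (e := e) t0) => //.
  + by rewrite z'_0 z_0.
  + exact: acz'.
  + by move=> r /andP[r0 rt]; apply: Zz' => //; apply: le_lt_trans tT; rewrite lee_fin.
  + by move=> r /andP[r0 _]; have [] := zc r r0.
  + apply: filterS dz' => r H r0 rt; apply: H => //.
    by apply: lt_trans tT; rewrite lte_fin.
  + by apply: filterS dz => r H r0 _; exact: H.
- move=> t t0; have w0 : 0 <= J z0 - J zstar by rewrite subr_ge0 Jmin.
  have [b0 Eb] := Hb _ _ w0 t0; set B := beta _ t in b0 Eb *.
  (* The estimate is proved with the larger of the two terms, which is at most their sum. *)
  pose s := Num.max B (gamma D).
  have s0 : 0 <= s by rewrite le_max b0.
  have sB : B <= s by rewrite le_max lexx.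
  have gs : gamma D <= s by rewrite le_max lexx orbT.
  have sle : s <= B + gamma D by rewrite ge_max lerDl lerDr b0 g0.
  apply: le_trans sle.
  have [||//|H] := @energy_decay _ _ Z zstar J eta oZ eta0 sJ cJ alpha Ka aJ
      z e t K c D s t0 zK _ eD _ s0 (sD _ gs).
  + by move=> r /andP[r0 _]; exact: zc.
  + by apply: filterS dz => r H r0 _; exact: H.
  (* Here the energy plus [t * rho s] is at most [B + t * rho B], hence at most [B + t * rho s]; so
     the energy is at most [B], against [sw]. *)
  + rewrite leNgt; apply/negP => sw; move: H; rewrite -rhoE// z_0 -Eb.
    have : t * rho B <= t * rho s.
      rewrite ler_wpM2l// !rhoE// ler_pM2l// ler_pXn2r ?nnegrE ?(K_ge0 Ka)//.
      exact: (K_le Ka).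
    lra.
Qed.
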